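(* Let $q$ be an odd prime power and let $P$ be a point of $\mathrm{PG}(5,q)$. The hyperplane-orbit distribution $OD_4(P)=[h_1,h_{2,r},h_{2,i},h_3]$ is: - $\left[q+1,\; q^3+\frac{3q^2+q}{2},\; \frac{q^2-q}{2},\; q^4-q^2\right]$ if $P\in\mathcal P_1$; - $\left[2q+1,\; \frac{q^3+3q^2}{2},\; \frac{q^3+q^2}{2}-q,\; q^4-q^2\right]$ if $P\in\mathcal P_{2,e}$; - $\left[1,\; \frac{q^3+3q^2}{2}+q,\; \frac{q^3+q^2}{2},\; q^4-q^2\right]$ if $P\in\mathcal P_{2,i}$; - $\left[q+1,\; \frac{q^3+2q^2+q}{2},\; \frac{q^3-q}{2},\; q^4\right]$ if $P\in\mathcal P_3$.
   Context: A point $P=(y_0,\dots,y_5)$ of $\mathrm{PG}(5,q)$ is identified with the nonzero symmetric matrix $M_P=\begin{bmatrix} y_0&y_1&y_2\\ y_1&y_3&y_4\\ y_2&y_4&y_5\end{bmatrix}$ up to scalar; the rank of $P$ is the rank of $M_P$. The Veronese surface $\mathcal V(\mathbb F_q)$ is the image of $\nu:(u_0,u_1,u_2)\mapsto(u_0^2,u_0u_1,u_0u_2,u_1^2,u_1u_2,u_2^2)$, i.e. the set of rank-1 points. The images under $\nu$ of lines of $\mathrm{PG}(2,q)$ are the conics of $\mathcal V(\mathbb F_q)$. Every rank-2 point $P$ lies in the plane of a unique such conic $\mathcal C(P)$. Point orbits ($q$ odd) under $K\cong\mathrm{PGL}(3,q)$ (acting by $M_P\mapsto AM_PA^T$): $\mathcal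 P_1$ = rank-1 points; $\mathcal P_{2,e}$ = exterior rank-2 points (lying on two tangent lines of $\mathcal C(P)$ in its plane); $\mathcal P_{2,i}$ = interior rank-2 points (lying on no tangent line of $\mathcal C(P)$); $\mathcal P_3$ = rank-3 points. Hyperplanes of $\mathrm{PG}(5,q)$ correspond to conics of $\mathrm{PG}(2,q)$ (nonzero quadratic forms up to scalar): the form $\sum_{0\le i\le j\le 2}a_{ij}X_iX_j$ corresponds to the hyperplane $a_{00}Y_0+a_{01}Y_1+a_{02}Y_2+a_{11}Y_3+a_{12}Y_4+a_{22}Y_5=0$. $\mathcal H_1,\mathcal H_{2,r},\mathcal H_{2,i},\mathcal H_3$ denote the sets of hyperplanes corresponding respectively to double lines (scalar multiples of squares of linear forms), pairs of distinct real lines (products of two non-proportional linear forms over $\mathbb F_q$), pairs of conjugate imaginary lines (scalar multiples of products of two non-proportional linear forms conjugate over $\mathbb F_{q^2}$), and non-singular conics. For a subspace $W$, $OD_4(W)=[h_1,h_{2,r},h_{2,i},h_3]$, where $h_1$ (resp. $h_{2,r},h_{2,i},h_3$) is the number of hyperplanes in $\mathcal H_1$ (resp. $\mathcal H_{2,r},\mathcal H_{2,i},\mathcal H_3$) containing $W$. *)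

(* Defs.v *)
From HB Require Import structures.
From mathcomp Require Import all_boot all_order all_algebra all_field.
From mathcomp Require Export mpoly.

Set Implicit Arguments.
Unset Strict Implicit.
Unset Printing Implicit Defensive.

Import GRing.Theory.
Local Open Scope ring_scope.

(* Subspaces of PG(n, F) are represented by the set of vectors of the
   corresponding linear subspace of F^(n+1) (zero vector included), so that a
   point is the set of all scalar multiples of a nonzero vector and incidence
   of subspaces is set inclusion.  Throughout, "point", "line", "plane" and
   "hyperplane" mean such sets, and d is the projective dimension. *)
Definition rowspace (F : finFieldType) (m n : nat) (A : 'M[F]_(m, n)) :
  {set 'rV[F]_n} := [set v | (v <= A)%MS].

Definition PG (F : finFieldType) (n d : nat) : {set {set 'rV[F]_n.+1}} :=
  [set rowspace A | A : 'M[F]_(d.+1, n.+1) & row_free A].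

Definition spanned (F : finFieldType) (n : nat) (C : {set {set 'rV[F]_n}}) :
  {set 'rV[F]_n} := rowspace (\sum_(v in cover C) <<v>>)%MS.

(* The position, among the six coordinates of PG(5, F), of entry (i, j) of a
   symmetric 3 x 3 matrix. *)
Definition sidx (i j : 'I_3) : 'I_6 :=
  inord (nth 0%N (nth [::] [:: [:: 0; 1; 2];
                               [:: 1; 3; 4];
                               [:: 2; 4; 5] ]%N i) j).

Definition symmx (F : finFieldType) (y : 'rV[F]_6) : 'M[F]_3 :=
  \matrix_(i, j) y 0 (sidx i j).

Definition rank_points (F : finFieldType) (r : nat) : {set {set 'rV[F]_6}} :=
  [set rowspace y | y : 'rV[F]_6 & (y != 0) && (\rank (symmx y) == r)].

Definition veronese (F : finFieldType) (u : 'rV[F]_3) : 'rV[F]_6 :=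
  let x i := u 0 (inord i) in
  \row_(k < 6) nth 0 [:: x 0%N ^+ 2; x 0%N * x 1%N; x 0%N * x 2%N;
                         x 1%N ^+ 2; x 1%N * x 2%N; x 2%N ^+ 2] k.

Definition veronese_conics (F : finFieldType) : {set {set {set 'rV[F]_6}}} :=
  [set [set rowspace (veronese u) | u in (l : {set 'rV[F]_3}) & u != 0]
     | l in PG F 2 1].

(* The plane of a conic C is the span of its points; a tangent is a line of
   that plane having exactly one point in common with C. *)
Definition tangents (F : finFieldType) (C : {set {set 'rV[F]_6}})
    (P : {set 'rV[F]_6}) : {set {set 'rV[F]_6}} :=
  [set t in PG F 5 1 | [&& t \subset spanned C, P \subset t
                         & #|[set Q in C | Q \subset t]| == 1%N]].

(* Rank-2 points lying on exactly k tangents of C(P): the conic C below is the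
   unique one whose plane contains P. *)
Definition rank2_points_on (F : finFieldType) (k : nat) :
  {set {set 'rV[F]_6}} :=
  [set P in rank_points F 2 |
    [exists C in veronese_conics F,
      (P \subset spanned C) && (#|tangents C P| == k)]].

Definition orbit_P1 (F : finFieldType) := rank_points F 1.
Definition orbit_P2e (F : finFieldType) := rank2_points_on F 2.
Definition orbit_P2i (F : finFieldType) := rank2_points_on F 0.
Definition orbit_P3 (F : finFieldType) := rank_points F 3.

Definition linform (R : nzRingType) (l : 'rV[R]_3) : {mpoly R[3]} :=
  \sum_(i < 3) l 0 i *: 'X_i.

Definition quadform (F : finFieldType) (a : 'rV[F]_6) : {mpoly F[3]} :=
  \sum_(i < 3) \sum_(j < 3 | (i <= j)%N) a 0 (sidx i j) *: ('X_i * 'X_j).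

Definition nonproportional (K : fieldType) (l m : 'rV[K]_3) : bool :=
  row_free (col_mx l m).

Definition is_double_line (F : finFieldType) (f : {mpoly F[3]}) : bool :=
  [exists c : F, exists l : 'rV[F]_3,
    [&& c != 0, l != 0 & f == c *: linform l ^+ 2]].

Definition is_real_line_pair (F : finFieldType) (f : {mpoly F[3]}) : bool :=
  [exists l : 'rV[F]_3, exists m : 'rV[F]_3,
    nonproportional l m && (f == linform l * linform m)].

(* Here L plays the role of the quadratic extension of F, embedded by iota;
   conjugation over F is then x |-> x ^+ #|F|. *)
Definition conj_form (F L : finFieldType) (l : 'rV[L]_3) : 'rV[L]_3 :=
  map_mx (fun x : L => x ^+ #|F|) l.

Definition is_imaginary_line_pair (F L : finFieldType)
    (iota : {rmorphism F -> L}) (f : {mpoly F[3]}) : bool :=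
  [exists c : F, exists l : 'rV[L]_3,
    [&& c != 0, nonproportional l (conj_form F l)
      & map_mpoly iota f
          == iota c *: (linform l * linform (conj_form F l))]].

(* Only F-rational singular points are considered: the partial derivatives of
   a quadratic form are linear forms over F, so in odd characteristic (where f
   vanishes with them, by Euler) a form with a singular point over an extension
   field has one over F. *)
Definition is_singular_point (F : finFieldType) (f : {mpoly F[3]})
    (u : 'rV[F]_3) : bool :=
  [&& u != 0, f.@[fun i => u 0 i] == 0
    & [forall k : 'I_3, (mderiv k f).@[fun i => u 0 i] == 0]].

Definition is_nonsingular (F : finFieldType) (f : {mpoly F[3]}) : bool :=
  [forall u : 'rV[F]_3, ~~ is_singular_point f u].

Definition form_hyperplane (F : finFieldType) (a : 'rV[F]_6) :
  {set 'rV[F]_6} := [set y : 'rV[F]_6 | \sum_(k < 6) a 0 k * y 0 k == 0].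

Definition hyperplanes_of (F : finFieldType) (p : pred {mpoly F[3]}) :
  {set {set 'rV[F]_6}} :=
  [set form_hyperplane a | a : 'rV[F]_6 & (a != 0) && p (quadform a)].

Definition orbit_H1 (F : finFieldType) := hyperplanes_of (@is_double_line F).
Definition orbit_H2r (F : finFieldType) :=
  hyperplanes_of (@is_real_line_pair F).
Definition orbit_H2i (F L : finFieldType) (iota : {rmorphism F -> L}) :=
  hyperplanes_of (is_imaginary_line_pair iota).
Definition orbit_H3 (F : finFieldType) := hyperplanes_of (@is_nonsingular F).

Definition containing (F : finFieldType) (W : {set 'rV[F]_6})
    (HH : {set {set 'rV[F]_6}}) : nat := #|[set H in HH | W \subset H]|.

Definition OD4 (F L : finFieldType) (iota : {rmorphism F -> L})
    (W : {set 'rV[F]_6}) : seq nat :=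
  [:: containing W (orbit_H1 F);
      containing W (orbit_H2r F);
      containing W (orbit_H2i iota);
      containing W (orbit_H3 F)].

(* Main.v *)
(* With M the symmetric matrix of the point y and W the Hessian of a quadratic
   form a, the hyperplane of a contains y iff tr (W M) = 0, and the four classes
   of forms are: rank W = 1; rank W = 2 with, resp. without, a zero off the
   kernel of W; rank W = 3.  Three counts determine their numbers.
   - Double lines c l^2 through y are the zeros l of the quadratic form M.
   - Line pairs l m through y are the pairs with l M m^T = 0, each form arising
     from 2(q-1) ordered pairs of independent vectors.
   - Counting the pairs (a, x) with a(x) = 0 in two ways gives the difference
     between real and imaginary pairs, since a form in the four classes has
     q^2, 2q^2 - q, q and q^2 zeros in F^3 respectively.
   A rank-2 point lies on a tangent of its conic iff M has a zero off its kernel,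
   which gives the number of zeros of M in each case. *)
Require Import Defs.
From HB Require Import structures.
From mathcomp Require Import all_boot all_order all_algebra all_field.
From mathcomp Require Import all_fingroup all_solvable mxabelem.
From mathcomp Require Import zify ring.

Set Implicit Arguments.
Unset Strict Implicit.
Unset Printing Implicit Defensive.

Import GRing.Theory.
Local Open Scope ring_scope.

(** * Squares in finite fields *)

(** All counts are of nonzero coefficient vectors, q - 1 for each hyperplane, and so become counts
    of matrices and vectors over F. A fourth equation completes the three counts: q^5 vectors
    annihilate y in all. The point enters this linear system only through the number N of zeros of M
    in F^3, the size K of the kernel of M, and the number e of vectors x whose Veronese image is a
    multiple of y. The system is triangular in the order h_1, h_{2,r}, h_{2,i}, h_3; it is solved
    over the rationals, where the halves of the answer make sense. The obstacle is the imaginary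
    pairs, whose factors live over L: the double count of zeros reaches them without counting
    vectors over L. *)

Lemma card_fibers (T U : finType) (f : T -> U) (A : {set T}) (k : nat) :
    {in A, forall x, #|[set x' in A | f x' == f x]| = k} ->
  #|A| = (#|f @: A| * k)%N.
Proof.
move=> fiber; rewrite -sum1_card (partition_big_imset f) /= -sum_nat_const.
apply: eq_bigr => _ /imsetP[x xA ->]; rewrite -(fiber x xA) -sum1_card.
by apply: eq_bigl => z; rewrite inE.
Qed.

Lemma two_neq0 (F : finFieldType) : odd #|F| -> 2 != 0 :> F.
Proof.
move=> oddF; apply/negP => /eqP two0.
have char2 : 2%N \in [pchar F] by rewrite inE /= two0 eqxx.
have := card_pprimeChar char2; move: oddF (finNzRing_gt1 F) => + + cardF.
by rewrite cardF oddX orbF => /eqP ->.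
Qed.

Lemma card_kernel (F : finFieldType) (m n : nat) (A : 'M[F]_(m, n)) :
  #|[set x : 'rV_m | x *m A == 0]| = (#|F| ^ (m - \rank A))%N.
Proof.
rewrite -mxrank_ker -card_rowg; apply: eq_card => x.
by rewrite inE mem_rowg; apply/eqP/sub_kermxP.
Qed.

(** A nonzero value cannot be both x^2 and nu y^2, or nu would be (x/y)^2; so the two counts add up
    to at most 2 at every t. Each of them sums to #|F| over all t, so the bound is attained
    everywhere. *)
Lemma card_scaled_squares (F : finFieldType) (nu t : F) : odd #|F| ->
    (forall s, s ^+ 2 != nu) ->
  (#|[set x : F | x ^+ 2 == t]| + #|[set x : F | (nu * x ^+ 2)%R == t]| = 2)%N.
Proof.
move=> oddF nonsq.
have two0 := two_neq0 oddF.
have nu0 : nu != 0 by apply: contra (nonsq 0) => /eqP->; rewrite expr0n.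
have sqE (x y : F) : (x ^+ 2 == y ^+ 2) = (x \in [set y; - y]).
  by rewrite eqf_sqr !inE.
pose r (c u : F) :=  #|[set x : F | c * x ^+ 2 == u]|.
have r_le2 c u : c != 0 -> (r c u <= 2)%N.
  move=> c0; rewrite /r; set A := [set x | _].
  case: (set_0Vmem A) => [->|[y]]; first by rewrite cards0.
  rewrite inE => /eqP uE.
  rewrite (leq_trans (subset_leq_card (_ : A \subset [set y; - y]))) //.
    apply/subsetP => x; rewrite inE -uE.
    by rewrite (inj_eq (mulfI c0)) sqE.
  by rewrite cards2; case: (_ != _).
have r_sum c : (\sum_u r c u)%N = #|F|.
  rewrite -[RHS]sum1_card [RHS](partition_big (fun x => c * x ^+ 2) xpredT) //=.
  apply: eq_bigr => u _; rewrite /r -sum1_card.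
  by apply: eq_bigl => x; rewrite inE.
have r0 (c : F) : c != 0 -> r c 0 = 1%N.
  move=> c0; rewrite -(cards1 (0 : F)); apply: eq_card => x.
  by rewrite !inE mulf_eq0 (negPf c0) expf_eq0.
have le2 (u : F) : (r 1%R u + r nu u <= 2)%N.
  have [-> | u0] := eqVneq u 0.
    by rewrite !r0 ?oner_eq0.
  case: (posnP (r 1 u)) => [->|]; first by rewrite add0n r_le2.
  case/card_gt0P => x; rewrite inE mul1r => /eqP xu.
  suff -> : r nu u = 0%N by rewrite addn0 r_le2 ?oner_eq0.
  apply: eq_card0 => y; rewrite inE; apply/negP => /eqP yu.
  have y0 : y != 0 by apply: contra u0 => /eqP y0; rewrite -yu y0 expr0n mulr0.
  have /eqP[] := nonsq (x / y).
  by rewrite expr_div_n xu -yu mulfK // expf_eq0.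
have : (\sum_(u : F) (r 1%R u + r nu u) = \sum_(u : F) 2)%N.
  by rewrite big_split !r_sum sum_nat_const /= muln2 addnn.
move/eqP; rewrite (bigD1 t) //= [X in _ == X](bigD1 t) //= => /eqP sumE.
have rest : (\sum_(u | u != t) (r 1%R u + r nu u) <= \sum_(u : F | u != t) 2)%N.
  exact: leq_sum.
have := le2 t; rewrite leq_eqVlt => /orP[/eqP eq2|lt2].
  rewrite -[RHS]eq2 /r; congr addn; apply: eq_card => x.
  by rewrite !inE mul1r.
by have := leq_add lt2 rest; rewrite addSn sumE ltnn.
Qed.

(** Squaring identifies 1 and -1, so on a finite field it is not onto. *)
Lemma exists_nonsquare (F : finFieldType) : odd #|F| ->
  exists nu : F, forall s, s ^+ 2 != nu.
Proof.
move=> oddF; have two0 := two_neq0 oddF.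
have [/existsP[nu /forallP nonsq]|] :=
  boolP [exists nu : F, [forall s, s ^+ 2 != nu]]; first by exists nu.
rewrite negb_exists => /forallP allsq.
have surj nu : exists s : F, s ^+ 2 = nu.
  have := allsq nu; rewrite negb_forall => /existsP[s].
  by rewrite negbK => /eqP; exists s.
have im : (fun s : F => s ^+ 2) @: [set: F] = [set: F].
  apply/setP => nu; rewrite inE; have [s <-] := surj nu.
  by apply/imsetP; exists s.
have /imset_injP inj : #|(fun s : F => s ^+ 2) @: [set: F]| == #|[set: F]|.
  by rewrite im.
have /eqP := inj 1 (- 1) (in_setT _) (in_setT _) (esym (sqrrN _)).
by rewrite -subr_eq0 opprK (negPf two0).
Qed.

(** For a generator g of the cyclic unit group and d = g^k, the hypothesis makes q - 1 divide k (q -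
    1)/2, so k is even. *)
Lemma euler_criterion (F : finFieldType) (d : F) : odd #|F| -> d != 0 ->
  d ^+ (#|F|.-1)./2 = 1 -> exists s, s ^+ 2 = d.
Proof.
move=> oddF d0 dpow.
have /cyclicP[g gen] := field_unit_group_cyclic [set: {unit F}]%G.
have ordg : #[g]%g = #|F|.-1 by rewrite orderE -gen card_finField_unit.
have q1 : (0 < #|F|.-1)%N by rewrite -ordg order_gt0.
have : FinRing.unit F (etrans (unitfE d) d0) \in <[g]>%g by rewrite -gen inE.
case/cycleP => k /(congr1 val); rewrite /= FinRing.val_unitX => dE.
have evq : (#|F|.-1 = (#|F|.-1)./2 * 2)%N.
  by rewrite muln2 even_halfK //; move: oddF; case: #|_| => //= n.
have : (g ^+ (k * (#|F|.-1)./2))%g = 1%g.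
  by apply: val_inj; rewrite /= FinRing.val_unitX exprM -dE dpow.
have half0 : (0 < (#|F|.-1)./2)%N by move: q1; rewrite {1}evq muln_gt0 andbT.
move/eqP; rewrite -order_dvdn ordg {1}evq [X in (_ %| X)%N]mulnC dvdn_pmul2l //.
case/dvdnP => j kE; exists (val g ^+ j).
by rewrite dE kE exprM.
Qed.

(** * Symmetric matrices and their isotropic vectors *)

Definition dot (R : pzRingType) (n : nat) (x y : 'rV[R]_n) : R :=
  (x *m y^T) 0 0.

(** The Hessian of the product of the linear forms with coefficient rows l and m; its quadratic form
    is twice that product. *)
Definition symouter (R : pzRingType) (n : nat) (l m : 'rV[R]_n) : 'M[R]_n :=
  l^T *m m + m^T *m l.

Definition isotropic (F : finFieldType) (n : nat) (S : 'M[F]_n) :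
  {set 'rV[F]_n} := [set x | dot (x *m S) x == 0].

(* On a symmetric matrix of rank 2, this says that the quadratic form is
   hyperbolic. *)
Definition has_regular_zero (F : finFieldType) (n : nat) (S : 'M[F]_n) : bool :=
  [exists z in isotropic S, z *m S != 0].

Lemma dotE (R : pzRingType) (n : nat) (x y : 'rV[R]_n) :
  dot x y = \sum_i x 0 i * y 0 i.
Proof. by rewrite /dot mxE; apply: eq_bigr => i _; rewrite mxE. Qed.

Lemma dotC (R : comPzRingType) (n : nat) (x y : 'rV[R]_n) : dot x y = dot y x.
Proof. by rewrite !dotE; apply: eq_bigr => i _; rewrite mulrC. Qed.

Lemma dotDl (R : pzRingType) (n : nat) (x y z : 'rV[R]_n) :
  dot (x + y) z = dot x z + dot y z.
Proof. by rewrite /dot mulmxDl mxE. Qed.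

Lemma dotDr (R : pzRingType) (n : nat) (x y z : 'rV[R]_n) :
  dot z (x + y) = dot z x + dot z y.
Proof. by rewrite /dot linearD mulmxDr mxE. Qed.

Lemma dotZl (R : pzRingType) (n : nat) (a : R) (x y : 'rV[R]_n) :
  dot (a *: x) y = a * dot x y.
Proof. by rewrite /dot -scalemxAl mxE. Qed.

Lemma dotZr (R : comPzRingType) (n : nat) (a : R) (x y : 'rV[R]_n) :
  dot x (a *: y) = a * dot x y.
Proof. by rewrite dotC dotZl dotC. Qed.

Lemma dot0l (R : pzRingType) (n : nat) (x : 'rV[R]_n) : dot 0 x = 0.
Proof. by rewrite /dot mul0mx mxE. Qed.

Lemma dot_mull (R : comPzRingType) (m n : nat) (S : 'M[R]_(m, n))
    (x : 'rV[R]_m) (y : 'rV[R]_n) :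
  dot (x *m S) y = dot x (y *m S^T).
Proof. by rewrite /dot trmx_mul trmxK mulmxA. Qed.

Lemma dot_delta (R : pzRingType) (n : nat) (x : 'rV[R]_n) (j : 'I_n) :
  dot x (delta_mx 0 j) = x 0 j.
Proof. by rewrite /dot trmx_delta -colE mxE. Qed.

Lemma mulmx_outer (R : comPzRingType) (m n : nat) (x l : 'rV[R]_m)
    (k : 'rV[R]_n) : x *m (l^T *m k) = dot x l *: k.
Proof. by rewrite mulmxA [x *m _]mx11_scalar mul_scalar_mx. Qed.

Lemma mulmx_symouter (R : comPzRingType) (n : nat) (x l m : 'rV[R]_n) :
  x *m symouter l m = dot x l *: m + dot x m *: l.
Proof. by rewrite mulmxDr !mulmx_outer. Qed.

Lemma symouterC (R : comPzRingType) (n : nat) (l m : 'rV[R]_n) :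
  symouter l m = symouter m l.
Proof. exact: addrC. Qed.

Lemma symouterZZ (R : comPzRingType) (n : nat) (a b : R) (l m : 'rV[R]_n) :
  symouter (a *: l) (b *: m) = (a * b) *: symouter l m.
Proof.
rewrite /symouter !linearZ /= scalerDr -!scalemxAl !scalerA.
by rewrite [b * a]mulrC.
Qed.

Lemma symouter_sym (R : comPzRingType) (n : nat) (l m : 'rV[R]_n) :
  (symouter l m)^T = symouter l m.
Proof. by rewrite linearD /= !trmx_mul !trmxK addrC. Qed.

Lemma qf_symouter (R : comPzRingType) (n : nat) (x l m : 'rV[R]_n) :
  dot (x *m symouter l m) x = 2 * (dot x l * dot x m).
Proof.
by rewrite mulmx_symouter dotDl !dotZl ![dot _ x]dotC; ring.
Qed.

Lemma dot_inj (R : pzRingType) (n : nat) (x y : 'rV[R]_n) :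
  (forall z, dot x z = dot y z) -> x = y.
Proof. by move=> eqxy; apply/rowP => j; rewrite -!dot_delta. Qed.

Lemma dotwC (R : comPzRingType) (n : nat) (S : 'M[R]_n) (x y : 'rV[R]_n) :
  S^T = S -> dot (x *m S) y = dot (y *m S) x.
Proof. by move=> symS; rewrite dot_mull symS dotC. Qed.

Lemma polarization (R : comPzRingType) (n : nat) (S : 'M[R]_n)
    (x y : 'rV[R]_n) : S^T = S ->
  dot ((x + y) *m S) (x + y)
    = dot (x *m S) x + dot (y *m S) y + 2 * dot (x *m S) y.
Proof.
move=> symS; rewrite mulmxDl dotDl !dotDr [dot (y *m S) x]dotwC //; ring.
Qed.

(** * Diagonalization of symmetric matrices *)

(** If the basis vectors e_i and e_j are both isotropic, polarization gives e_i + e_j the value 2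
    S_ij. *)
Lemma exists_nonisotropic (F : fieldType) (n : nat) (S : 'M[F]_n) :
    2 != 0 :> F -> S^T = S -> S != 0 ->
  exists v, dot (v *m S) v != 0.
Proof.
move=> two0 symS /matrix0Pn[i [j Sij]].
have SijE : dot (delta_mx 0 i *m S) (delta_mx 0 j) = S i j.
  by rewrite dot_delta -rowE mxE.
have := polarization (delta_mx 0 i) (delta_mx 0 j) symS.
have [->|ne _] := eqVneq (dot (delta_mx 0 i *m S) (delta_mx 0 i)) 0; last first.
  by exists (delta_mx 0 i).
have [->|ne _] := eqVneq (dot (delta_mx 0 j *m S) (delta_mx 0 j)) 0; last first.
  by exists (delta_mx 0 j).
move=> qE; exists (delta_mx 0 i + delta_mx 0 j).
by rewrite qE SijE !add0r mulf_neq0.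
Qed.

(** One step of Lagrange reduction. The new matrix kills the kernel of S and also v, so its rank
    drops; subtracting a matrix of rank at most 1 lowers the rank by at most 1. *)
Lemma rank_reduction (F : fieldType) (n : nat) (S : 'M[F]_n) (v : 'rV[F]_n) :
    S^T = S -> dot (v *m S) v != 0 ->
  (\rank (S - (dot (v *m S) v)^-1 *: ((v *m S)^T *m (v *m S)))).+1 = \rank S.
Proof.
set c := dot _ _ => symS c0; set S' := S - _.
have killE x : x *m S' = x *m S - (c^-1 * dot x (v *m S)) *: (v *m S).
  by rewrite mulmxBr -scalemxAr mulmx_outer scalerA.
apply/eqP; rewrite eqn_leq; apply/andP; split; last first.
  rewrite -[S in (\rank S <= _)%N](subrK (c^-1 *: ((v *m S)^T *m (v *m S)))).
  rewrite (leq_trans (mxrank_add _ _)) // -[X in (_ <= X)%N]addn1 leq_add2l.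
  rewrite (leq_trans (mxrank_scale _ _)) //.
  by rewrite (leq_trans (mxrankM_maxr _ _)) // rank_leq_row.
have : (kermx S < kermx S')%MS.
  rewrite /ltmx; apply/andP; split.
    apply/row_subP => i; apply/sub_kermxP; rewrite killE.
    have kS : row i (kermx S) *m S = 0 by rewrite -row_mul mulmx_ker row0.
    by rewrite kS dotC dot_mull symS kS dotC dot0l mulr0 scale0r subrr.
  apply/negP => sub; have vK : (v <= kermx S')%MS.
    apply/sub_kermxP; rewrite killE [dot v _]dotC -/c mulVf // scale1r.
    exact: subrr.
  have /sub_kermxP vS := submx_trans vK sub.
  by move: c0; rewrite /c vS dot0l eqxx.
move/rank_ltmx; rewrite !mxrank_ker ltn_sub2lE //.
exact: rank_leq_row.
Qed.

Lemma symmetric_diagonalization (F : fieldType) (n : nat) (S : 'M[F]_n) :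
    2 != 0 :> F -> S^T = S ->
  exists (B : 'M[F]_(\rank S, n)) (a : 'rV[F]_(\rank S)),
    [/\ row_free B, forall i, a 0 i != 0 & S = B^T *m diag_mx a *m B].
Proof.
move=> two0; move rS: (\rank S) => r symS.
suff [B [a [a0 SE]]] : exists (B : 'M[F]_(r, n)) (a : 'rV[F]_r),
    (forall i, a 0 i != 0) /\ S = B^T *m diag_mx a *m B.
  (* Freeness of B need not be carried through the induction: S factors through B, whose rank is
     thus at least r. *)
  exists B, a; split=> //; rewrite /row_free eqn_leq rank_leq_row -{1}rS SE.
  exact: mxrankM_maxr.
elim: r => [|r IHr] in S rS symS *.
  exists 0, 0; split=> [[]//|]; rewrite mulmx0.
  by apply/eqP; rewrite -mxrank_eq0 rS.
have S0 : S != 0 by rewrite -mxrank_eq0 rS.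
have [v v0] := exists_nonisotropic two0 symS S0.
set c := dot _ _ in v0; pose u := v *m S.
have := rank_reduction symS v0; rewrite rS -/c -/u => -[/IHr].
case=> [|B [a [a0 S'E]]].
  by rewrite linearB linearZ /= trmx_mul trmxK symS.
exists (col_mx u B), (row_mx (c^-1)%:M a); split.
  move=> i; rewrite mxE; case: splitP => j _ //.
  by rewrite ord1 mxE eqxx mulr1n invr_eq0.
(* Restating at 1 + r, convertible to r.+1, exposes the blocks. *)
suff: S = (col_mx u B)^T *m diag_mx (row_mx (c^-1)%:M a) *m col_mx u B by [].
rewrite tr_col_mx diag_mx_row mul_row_block !mulmx0 addr0 add0r mul_row_col.
rewrite -S'E [X in diag_mx X](_ : _ = const_mx c^-1); last first.
  by apply/rowP => j; rewrite !mxE ord1 eqxx.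
by rewrite diag_const_mx mul_mx_scalar -scalemxAl addrC subrK.
Qed.

(** The columns of a right inverse give dual vectors z and w; independence is used below mostly by
    pairing with them. *)
Lemma row_free2P (F : fieldType) (n : nat) (l m : 'rV[F]_n) :
    row_free (col_mx l m) ->
  exists z w : 'rV_n, [/\ dot z l = 1, dot z m = 0, dot w l = 0 & dot w m = 1].
Proof.
move=> /row_freeP[A]; rewrite -[A]hsubmxK mul_col_row scalar_mx_block.
case/eq_block_mx => lz lw mz mw.
exists (lsubmx A)^T, (rsubmx A)^T.
by split; rewrite dotC /dot trmxK ?lz ?lw ?mz ?mw mxE.
Qed.

Lemma row_free_dual (F : fieldType) (n : nat) (l m z w : 'rV[F]_n) :
    dot z l != 0 -> dot z m = 0 -> dot w l = 0 -> dot w m != 0 ->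
  row_free (col_mx l m).
Proof.
move=> zl zm wl wm; rewrite -kermx_eq0; apply/rowV0P => x /sub_kermxP.
rewrite -[x]hsubmxK mul_row_col (mx11_scalar (lsubmx x)) (mx11_scalar (rsubmx x)).
rewrite !mul_scalar_mx => e.
have := congr1 (fun v => dot v z) e; have := congr1 (fun v => dot v w) e.
rewrite /= !dotDl !dotZl !dot0l ![dot _ z]dotC ![dot _ w]dotC zm wl !mulr0 addr0 add0r.
move=> /eqP; rewrite mulf_eq0 (negPf wm) orbF => /eqP->.
move=> /eqP; rewrite mulf_eq0 (negPf zl) orbF => /eqP->.
by apply/rowP => i; rewrite mxE; case: splitP => j _; rewrite !mxE mul0rn.
Qed.

Lemma rank1_symmetric (F : fieldType) (n : nat) (S : 'M[F]_n) :
    2 != 0 :> F -> S^T = S -> \rank S = 1%N ->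
  exists (c : F) (l : 'rV_n), [/\ c != 0, l != 0 & S = c *: (l^T *m l)].
Proof.
move=> two0 symS rS.
have := symmetric_diagonalization two0 symS; rewrite rS.
case=> l [a [freel a0 SE]]; exists (a 0 0), l; split=> //.
  by apply: contraTneq freel => ->; rewrite /row_free mxrank0.
by rewrite SE [diag_mx a]mx11_scalar mul_mx_scalar mxE eqxx -scalemxAl.
Qed.

Lemma rank2_symmetric (F : fieldType) (n : nat) (S : 'M[F]_n) :
    2 != 0 :> F -> S^T = S -> \rank S = 2%N ->
  exists (a b : F) (l m : 'rV_n), [/\ a != 0, b != 0, row_free (col_mx l m)
    & S = a *: (l^T *m l) + b *: (m^T *m m)].
Proof.
move=> two0 symS rS.
have := symmetric_diagonalization two0 symS; rewrite rS.
case=> B [a]; rewrite -[B](@vsubmxK _ 1 1) => -[freeB a0 SE].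
exists (a 0 0), (a 0 1), (usubmx (B : 'M_(1 + 1, n))), (dsubmx (B : 'M_(1 + 1, n))).
split=> //; move: (usubmx _) (dsubmx _) SE => l m ->.
have aE : a = row_mx (a 0 0)%:M (a 0 1)%:M :> 'rV_(1 + 1).
  apply/rowP => i; rewrite mxE; case: splitP => j; rewrite ord1 => iE.
    by rewrite mxE eqxx; congr (a _ _); apply: val_inj.
  by rewrite mxE eqxx; congr (a _ _); apply: val_inj.
have diagE : diag_mx (row_mx (a 0 0)%:M (a 0 1)%:M : 'rV_(1 + 1))
    = block_mx (a 0 0)%:M 0 0 (a 0 1)%:M.
  rewrite diag_mx_row.
  by congr block_mx; apply/matrixP => i j; rewrite !ord1 !mxE !eqxx.
rewrite (etrans (congr1 (@diag_mx _ _) aE) diagE).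
have -> : (col_mx l m)^T = row_mx l^T m^T by exact: tr_col_mx.
have E : row_mx l^T m^T *m block_mx (a 0 0)%:M 0 0 (a 0 1)%:M *m col_mx l m
          = a 0 0 *: (l^T *m l) + a 0 1 *: (m^T *m m).
  rewrite mul_row_block !mulmx0 addr0 add0r mul_row_col.
  by rewrite !mul_mx_scalar -!scalemxAl.
exact: E.
Qed.

(** * Numbers of zeros of quadratic forms *)

Lemma card_pairs (T U : finType) (P : T -> U -> bool) :
  #|[set p : T * U | P p.1 p.2]| = (\sum_x #|[set y | P x y]|)%N.
Proof.
rewrite -sum1dep_card -(pair_big_dep xpredT P (fun _ _ => 1%N)) /=.
by apply: eq_bigr => x _; rewrite sum1dep_card.
Qed.

Lemma sum_ord3 (V : nmodType) (f : 'I_3 -> V) :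
  \sum_i f i = f 0 + f 1 + f 2%:R.
Proof.
rewrite !big_ord_recl big_ord0 addr0 addrA.
by congr (f _ + f _ + f _); apply: val_inj.
Qed.

(* Scaling one coefficient by a nonsquare sends the number N of zeros to
   2q^2 - N; scaling all three gives back the same zeros, so N = q^2. *)
Lemma card_ternary_zeros (F : finFieldType) (a b c : F) :
    odd #|F| -> a != 0 -> b != 0 -> c != 0 ->
  #|[set p : F * F * F |
      a * p.1.1 ^+ 2 + b * p.1.2 ^+ 2 + c * p.2 ^+ 2 == 0]| = (#|F| ^ 2)%N.
Proof.
move=> oddF a0 b0 c0; have [nu nonsq] := exists_nonsquare oddF.
have nu0 : nu != 0 by apply: contra (nonsq 0) => /eqP->; rewrite expr0n.
pose N (a b c : F) := #|[set p : F * F * F |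
      a * p.1.1 ^+ 2 + b * p.1.2 ^+ 2 + c * p.2 ^+ 2 == 0]|.
have NE (a' b' c' : F) : N a' b' c' = (\sum_(p : F * F)
    #|[set z : F | (c' * z ^+ 2 == - (a' * p.1 ^+ 2 + b' * p.2 ^+ 2))%R]|)%N.
  rewrite /N -(card_pairs (fun p z => _)) /=; apply: eq_card => -[p z].
  by rewrite !inE /= addrC addr_eq0.
have step a' b' c' : c' != 0 ->
    (N a' b' c' + N a' b' (nu * c')%R = 2 * #|F| ^ 2)%N.
  move=> c'0; rewrite !NE -big_split /= -[X in (_ = _ * X)%N]mulnn -card_prod.
  rewrite mulnC -sum_nat_const; apply: eq_bigr => p _.
  rewrite -[RHS](card_scaled_squares (- (a' * p.1 ^+ 2 + b' * p.2 ^+ 2) / c')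
    oddF nonsq).
  congr addn; apply: eq_card => z; rewrite !inE.
    by rewrite -[RHS](inj_eq (mulfI c'0)) [c' * (_ / _)]mulrC divfK.
  by rewrite -[RHS](inj_eq (mulfI c'0)) [c' * (_ / _)]mulrC divfK //
       [c' * (nu * _)]mulrCA mulrA.
have swap a' b' c' : N a' b' c' = N a' c' b'.
  pose f (p : F * F * F) := ((p.1.1, p.2), p.1.2).
  have fK : involutive f by case=> [[]].
  rewrite /N -(on_card_preimset (f := f)); last first.
    exact: onW_bij (inv_bij fK).
  by apply: eq_card => -[[x y] z]; rewrite !inE /= addrAC.
have swap' a' b' c' : N a' b' c' = N c' b' a'.
  pose f (p : F * F * F) := ((p.2, p.1.2), p.1.1).
  have fK : involutive f by case=> [[]].
  rewrite /N -(on_card_preimset (f := f)); last first.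
    exact: onW_bij (inv_bij fK).
  by apply: eq_card => -[[x y] z]; rewrite !inE /=; congr (_ == 0); ring.
have scale : N (nu * a) (nu * b) (nu * c) = N a b c.
  apply: eq_card => p; rewrite !inE -!mulrA -!mulrDr mulf_eq0.
  by rewrite (negPf nu0).
have e1 := step a b c c0.
have e2 : (N a b (nu * c)%R + N a (nu * b)%R (nu * c)%R = 2 * #|F| ^ 2)%N.
  by rewrite ![N a _ (nu * c)]swap step.
have e3 : (N a (nu * b)%R (nu * c)%R + N a b c = 2 * #|F| ^ 2)%N.
  by rewrite -scale ![N _ (nu * b) (nu * c)]swap' step.
move: e1 e2 e3; rewrite -/(N a b c).
move: (N a b c) (N a b (nu * c)) (N a (nu * b) (nu * c)) => x y z; move: (#|F| ^ 2)%N => s.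
rewrite !mul2n -!addnn => e1 e2 e3.
have xz : x = z by apply/eqP; rewrite -(eqn_add2r y) e1 -e2 addnC.
by move: e3; rewrite -xz !addnn => /double_inj.
Qed.

(** In the coordinates x B^T the form is diagonal with three nonzero coefficients. *)
Lemma card_isotropic_rank3 (F : finFieldType) (S : 'M[F]_3) :
  odd #|F| -> S^T = S -> \rank S = 3%N -> #|isotropic S| = (#|F| ^ 2)%N.
Proof.
move=> oddF symS rS.
have := symmetric_diagonalization (two_neq0 oddF) symS; rewrite rS.
case=> B [a [freeB a0 SE]].
rewrite -(card_ternary_zeros oddF (a0 0) (a0 1) (a0 2%:R)).
have unitB : B^T \in unitmx by rewrite unitmx_tr -row_free_unit.
pose f (p : F * F * F) : 'rV_3 :=
  (\row_i nth 0 [:: p.1.1; p.1.2; p.2] i) *m invmx B^T.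
have bijf : bijective f.
  exists (fun x => let z := x *m B^T in (z 0 0, z 0 1, z 0 2%:R)).
    by case=> [[x y] z]; rewrite /f mulmxKV //= !mxE.
  move=> x; rewrite /f /= -[RHS](mulmxK unitB); congr (_ *m _).
  by apply/rowP => -[[|[|[|//]]] lt_i]; rewrite mxE; congr ((x *m _) _ _);
     apply: val_inj.
rewrite -(on_card_preimset (f := f)); last exact: onW_bij.
apply: eq_card => p; rewrite !inE SE mulmxA dot_mull mulmxA /f mulmxKV //.
rewrite dotE mul_mx_diag sum_ord3 !mxE /=; congr (_ == 0).
by ring.
Qed.

Lemma card_isotropic_singular (F : finFieldType) (n : nat) (S : 'M[F]_n) :
  ~~ has_regular_zero S -> #|isotropic S| = (#|F| ^ (n - \rank S))%N.
Proof.
move=> nreg; rewrite -card_kernel; apply: eq_card => x; rewrite !inE.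
apply/idP/idP => [xS|/eqP->]; last by rewrite dot0l.
by apply: contraR nreg => xS0; apply/exists_inP; exists x; rewrite ?inE.
Qed.

Lemma rank1_no_regular_zero (F : finFieldType) (n : nat) (S : 'M[F]_n) :
  2 != 0 :> F -> S^T = S -> \rank S = 1%N -> ~~ has_regular_zero S.
Proof.
move=> two0 symS rS; have [c [l [c0 l0 ->]]] := rank1_symmetric two0 symS rS.
apply/exists_inPn => x; rewrite inE negbK -scalemxAr mulmx_outer scalerA dotZl.
rewrite [dot l x]dotC -mulrA mulf_eq0 (negPf c0) -expr2 expf_eq0 /= => /eqP->.
by rewrite mulr0 scale0r.
Qed.

(** * Products of two linear forms *)

(** The rank is at most 2 because the matrix factors through F^2, and at least 2 because it maps the
    dual vectors w and z to l and m. *)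
Lemma rank_symouter (F : fieldType) (n : nat) (l m : 'rV[F]_n) :
  row_free (col_mx l m) -> \rank (symouter l m) = 2%N.
Proof.
move=> free; have [z [w [zl zm wl wm]]] := row_free2P free.
apply/eqP; rewrite eqn_leq; apply/andP; split.
  rewrite /symouter -mul_row_col -[X in (_ <= X)%N]/(1 + 1)%N.
  exact: leq_trans (mxrankM_maxl _ _) (rank_leq_col _).
rewrite -[X in (X <= _)%N](eqP free); apply: mxrankS.
rewrite col_mx_sub; apply/andP; split; apply/submxP.
  by exists w; rewrite mulmx_symouter wl wm scale0r add0r scale1r.
by exists z; rewrite mulmx_symouter zl zm scale0r addr0 scale1r.
Qed.

Lemma symouter_regular_zero (F : finFieldType) (n : nat) (l m : 'rV[F]_n) :
  row_free (col_mx l m) -> has_regular_zero (symouter l m).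
Proof.
move=> free; have [z [w [zl zm wl wm]]] := row_free2P free.
apply/exists_inP; exists z; first by rewrite inE qf_symouter zm !mulr0.
rewrite mulmx_symouter zl zm scale0r addr0 scale1r.
by apply: contra_eqN wm => /eqP->; rewrite dotC dot0l eq_sym oner_eq0.
Qed.


Lemma outerE (R : pzRingType) (m n : nat) (l : 'rV[R]_m) (k : 'rV[R]_n)
    (i : 'I_m) (j : 'I_n) : (l^T *m k) i j = l 0 i * k 0 j.
Proof. by rewrite mxE big_ord1 mxE. Qed.

(** Factoring a difference of squares turns a diagonal form into a product once a square root s is
    available, in F for real pairs and in L for imaginary ones. *)
Lemma symouter_sub_add (R : comPzRingType) (n : nat) (l m : 'rV[R]_n) (s : R) :
  symouter (l - s *: m) (l + s *: m)
    = 2 *: (l^T *m l - s ^+ 2 *: (m^T *m m)).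
Proof.
apply/matrixP => i j; rewrite [LHS]mxE !outerE !mxE !big_ord1 !mxE; ring.
Qed.

Lemma row_free_sub_add (F : fieldType) (n : nat) (l m : 'rV[F]_n) (s : F) :
    2 != 0 :> F -> s != 0 -> row_free (col_mx l m) ->
  row_free (col_mx (l - s *: m) (l + s *: m)).
Proof.
move=> two0 s0 /row_free2P[z [w [zl zm wl wm]]].
have dE a b c : dot (s *: z + a *: w) (b *: (l + c *: m)) = b * (s + a * c).
  by rewrite dotZr dotDl !dotZl !dotDr !dotZr zl zm wl wm; ring.
have := dE (-1) 1 (- s); have := dE (-1) 1 s; have := dE 1 1 (- s).
have := dE 1 1 s; rewrite !scaleNr !scale1r => e1 e2 e3 e4.
(* These vectors are dual to the pair up to the factor 2 s. *)
apply: (row_free_dual (z := s *: z - w) (w := s *: z + w)).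
- by rewrite e4 mul1r mulrNN mul1r -mulr2n -mulr_natl mulf_neq0.
- by rewrite e3; ring.
- by rewrite e2; ring.
- by rewrite e1 !mul1r -mulr2n -mulr_natl mulf_neq0.
Qed.

Lemma row_freeZl (F : fieldType) (n : nat) (l m : 'rV[F]_n) (a : F) :
  a != 0 -> row_free (col_mx l m) -> row_free (col_mx (a *: l) m).
Proof.
move=> a0 /row_free2P[z [w [zl zm wl wm]]].
apply: (row_free_dual (z := z) (w := w)); rewrite ?dotZr //.
- by rewrite zl mulr1.
- by rewrite wl mulr0.
- by rewrite wm oner_eq0.
Qed.

(** A zero z of a l^2 + b m^2 off the kernel exhibits -b/a as the square of (z.l)/(z.m), so the form
    is a difference of squares. *)
Lemma rank2_regular_zeroP (F : finFieldType) (n : nat) (S : 'M[F]_n) :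
    2 != 0 :> F -> S^T = S -> \rank S = 2%N -> has_regular_zero S ->
  exists l m : 'rV_n, row_free (col_mx l m) /\ S = symouter l m.
Proof.
move=> two0 symS rS.
have [a [b [l [m [a0 b0 free ->]]]]] := rank2_symmetric two0 symS rS.
case/exists_inP => z; rewrite inE.
rewrite mulmxDr -!scalemxAr !mulmx_outer dotDl !dotZl [dot l z]dotC [dot m z]dotC.
move=> /eqP z0 zS0.
(* Were z.m zero, z.l would be too, and z would lie in the kernel. *)
have zm0 : dot z m != 0.
  apply: contra zS0 => /eqP zm; move/eqP: z0; rewrite zm mul0r mulr0 addr0.
  rewrite mulf_eq0 (negPf a0) -expr2 expf_eq0 /= => /eqP->.
  by rewrite !scale0r !scaler0 addr0.
pose s := dot z l / dot z m.
have bE : b = - (a * s ^+ 2).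
  have -> : b = - (a * (dot z l * dot z l)) / (dot z m) ^+ 2.
    by move/eqP: z0; rewrite addrC addr_eq0 => /eqP <-; field.
  by rewrite /s; field.
have s0 : s != 0.
  by apply: contra b0 => /eqP s0; rewrite bE s0 expr0n mulr0 oppr0.
(* The factor a / 2 absorbs the 2 of [symouter_sub_add]. *)
exists ((a / 2) *: (l - s *: m)), (l + s *: m); split.
  by rewrite row_freeZl ?row_free_sub_add // mulf_neq0 ?invr_eq0.
rewrite -[l + s *: m]scale1r symouterZZ symouter_sub_add mulr1 scalerA divfK //.
by rewrite scalerBr scalerA bE scaleNr.
Qed.

(** Inclusion-exclusion for the hyperplanes orthogonal to l and to m, which meet in the kernel; the
    additive form avoids truncated subtraction. *)
Lemma card_isotropic_symouter (F : finFieldType) (n : nat) (l m : 'rV[F]_n) :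
    2 != 0 :> F -> row_free (col_mx l m) ->
  (#|isotropic (symouter l m)| + #|F| ^ (n - 2) = 2 * #|F| ^ n.-1)%N.
Proof.
move=> two0 free; have [z [w [zl zm wl wm]]] := row_free2P free.
have card_perp (k : 'rV[F]_n) : k != 0 ->
    #|[set x | dot x k == 0]| = (#|F| ^ n.-1)%N.
  move=> k0; rewrite -subn1 -[X in (_ - X)%N](_ : \rank k^T = _); last first.
    by apply/eqP; rewrite mxrank_tr eqn_leq rank_leq_row lt0n mxrank_eq0.
  rewrite -card_kernel; apply: eq_card => x; rewrite !inE.
  by rewrite [x *m _]mx11_scalar -scalemx1 scaler_eq0 (negPf (matrix_nonzero1 _ _)) orbF.
have l0 : l != 0.
  by apply: contra_eqN zl => /eqP->; rewrite dotC dot0l eq_sym oner_eq0.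
have m0 : m != 0.
  by apply: contra_eqN wm => /eqP->; rewrite dotC dot0l eq_sym oner_eq0.
rewrite mul2n -addnn -{1}(card_perp l l0) -(card_perp m m0) -cardsUI; congr addn.
  apply: eq_card => x; rewrite !inE qf_symouter mulf_eq0 (negPf two0) /=.
  by rewrite mulf_eq0.
rewrite -(rank_symouter free) -card_kernel; apply: eq_card => x; rewrite !inE.
rewrite mulmx_symouter; apply/eqP/andP => [e|[/eqP-> /eqP->]]; last first.
  by rewrite !scale0r addr0.
have := congr1 (fun v => dot v z) e; have := congr1 (fun v => dot v w) e.
rewrite /= !dotDl !dotZl !dot0l ![dot _ z]dotC ![dot _ w]dotC zl zm wl wm.
by rewrite !mulr1 !mulr0 addr0 add0r => -> ->.
Qed.

(** * Conjugate factors over the quadratic extension *)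

(** #|F| is a power of the characteristic that F and L share. *)
Lemma exprD_card (F L : finFieldType) (iota : {rmorphism F -> L}) (x y : L) :
  (x + y) ^+ #|F| = x ^+ #|F| + y ^+ #|F|.
Proof.
have [p _ pcharF] := finPcharP F.
rewrite exprDn_pchar // (card_pprimeChar pcharF) pnatX.
by rewrite pnatE ?(pcharf_prime pcharF) // (fmorph_pchar iota) pcharF.
Qed.

Lemma conj_dot (F L : finFieldType) (iota : {rmorphism F -> L}) (n : nat)
    (x y : 'rV[L]_n) :
  dot (map_mx (fun a => a ^+ #|F|) x) (map_mx (fun a => a ^+ #|F|) y)
    = dot x y ^+ #|F|.
Proof.
have pow0 : (0 : L) ^+ #|F| = 0.
  by rewrite expr0n (gtn_eqF (ltnW (finNzRing_gt1 F))).
rewrite !dotE (big_morph _ (exprD_card iota) pow0).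
by apply: eq_bigr => i _; rewrite !mxE exprMn.
Qed.

(** With q = #|F|, d^((q^2-1)/2) = (d^(q-1))^((q+1)/2) = 1, so d acquires a root t in L. Then t^q =
    t d^((q-1)/2), where the last factor is 1 or -1; the value 1 would make d a square in F by
    [euler_criterion]. *)
Lemma conj_sqrt_nonsquare (F L : finFieldType) (iota : {rmorphism F -> L})
    (d : F) : odd #|F| -> #|L| = (#|F| ^ 2)%N ->
    (forall s, s ^+ 2 != d) ->
  exists t : L, t ^+ 2 = iota d /\ t ^+ #|F| = - t.
Proof.
move=> oddF cardL nonsq.
have d0 : d != 0 by apply: contraNneq (nonsq 0) => ->; rewrite expr0n.
have q_gt1 := finNzRing_gt1 F.
have qE : (#|F| = ((#|F|.-1)./2).*2.+1)%N.
  rewrite even_halfK ?prednK ?(ltnW q_gt1) //.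
  by move: oddF; case: #|_| => //= n.
have dpow : d ^+ #|F|.-1 = 1.
  apply: (mulfI d0); rewrite -exprS prednK ?(ltnW q_gt1) // mulr1.
  exact: expf_card.
have oddL : odd #|L| by rewrite cardL oddX oddF.
have [t tE] : exists t : L, t ^+ 2 = iota d.
  apply: euler_criterion; rewrite ?fmorph_eq0 //.
  have -> : ((#|L|.-1)./2 = #|F|.-1 * ((#|F|.-1)./2).+1)%N.
    rewrite cardL qE; move: ((#|F|.-1)./2) => h.
    have -> : ((h.*2.+1) ^ 2 = (h.*2 * h.+1).*2.+1)%N by rewrite -!muln2; nia.
    by rewrite !succnK !doubleK.
  by rewrite exprM -rmorphXn dpow rmorph1 expr1n.
exists t; split=> //.
have tq : t ^+ #|F| = t * iota (d ^+ (#|F|.-1)./2).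
  by rewrite {1}qE exprS -mul2n exprM tE rmorphXn.
have : (d ^+ (#|F|.-1)./2) ^+ 2 == 1 ^+ 2.
  rewrite -exprM muln2 even_halfK ?expr1n ?dpow //.
  by move: oddF; case: #|_| => //= n.
rewrite eqf_sqr => /orP[/eqP|/eqP dN]; last by rewrite tq dN rmorphN1 mulrN1.
case/(euler_criterion oddF d0) => s sE.
by case/eqP: (nonsq s).
Qed.

(** In the diagonal form a l^2 + b m^2 the ratio -b/a is a nonsquare. Its root t in L satisfies t^q
    = -t, so l - t m and l + t m are conjugate, with product l^2 + (b/a) m^2. *)
Lemma rank2_imaginary (F L : finFieldType) (iota : {rmorphism F -> L})
    (S : 'M[F]_3) :
    odd #|F| -> #|L| = (#|F| ^ 2)%N -> S^T = S -> \rank S = 2%N ->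
    ~~ has_regular_zero S ->
  exists (c : F) (l : 'rV[L]_3), [/\ c != 0, row_free (col_mx l (conj_form F l))
    & map_mx iota S = iota c *: symouter l (conj_form F l)].
Proof.
move=> oddF cardL symS rS nreg; have two0 := two_neq0 oddF.
have [a [b [l [m [a0 b0 free SE]]]]] := rank2_symmetric two0 symS rS.
have nonsq s : s ^+ 2 != - b / a.
  apply: contra nreg => /eqP sE; have [z [w [zl zm wl wm]]] := row_free2P free.
  (* The value here is a s^2 + b = 0, while w pairs with the image of this vector to b, so it is not
     in the kernel. *)
  apply/exists_inP; exists (s *: z + w).
    rewrite inE SE mulmxDr -!scalemxAr !mulmx_outer !dotDl !dotZl.
    rewrite ![dot _ (s *: z + w)]dotC !dotDl !dotZl zl zm wl wm.
    by rewrite !(mulr0, mulr1, addr0, add0r) -expr2 sE; apply/eqP; field.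
  rewrite SE mulmxDr -!scalemxAr !mulmx_outer !dotDl !dotZl zl zm wl wm.
  rewrite !(mulr0, mulr1, addr0, add0r) scale1r; apply/eqP.
  move/(congr1 (dot w)); rewrite dotDr !dotZr wl wm dotC dot0l !mulr0 add0r mulr1.
  exact/eqP.
have [t [tE tq]] := conj_sqrt_nonsquare iota oddF cardL nonsq.
have two0L : 2 != 0 :> L by rewrite -(rmorph_nat iota) fmorph_eq0.
have t0 : t != 0.
  rewrite -[t == 0](expf_eq0 t 2) tE fmorph_eq0 mulf_eq0 oppr_eq0 (negPf b0).
  by rewrite invr_eq0.
pose k := map_mx iota l - t *: map_mx iota m.
have kE : conj_form F k = map_mx iota l + t *: map_mx iota m.
  apply/rowP => j; rewrite !mxE (exprD_card iota) -!rmorphXn expf_card -mulNr.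
  by rewrite -tq exprMn -rmorphXn expf_card -exprM mulnn -cardL expf_card.
exists (a / 2), k; split.
- by rewrite mulf_neq0 ?invr_eq0.
- by rewrite kE row_free_sub_add // -map_col_mx row_free_map.
rewrite kE symouter_sub_add scalerA fmorph_div rmorph_nat divfK // tE scalerBr.
rewrite scalerA -rmorphM mulrC divfK // SE map_mxD !map_mxZ !map_mxM !map_trmx.
by rewrite rmorphN scaleNr opprK.
Qed.

(** At an F-rational z the value is 2 c (z.l)^(q+1), a norm up to a scalar: it vanishes only if z.l
    does, and then so does the conjugate of z.l, which puts z in the kernel. *)
Lemma imaginary_rank2 (F L : finFieldType) (iota : {rmorphism F -> L})
    (S : 'M[F]_3) (c : F) (l : 'rV[L]_3) :
    odd #|F| -> c != 0 -> row_free (col_mx l (conj_form F l)) ->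
    map_mx iota S = iota c *: symouter l (conj_form F l) ->
  \rank S = 2%N /\ ~~ has_regular_zero S.
Proof.
move=> oddF c0 free SE; have two0 := two_neq0 oddF.
have ic0 : iota c != 0 by rewrite fmorph_eq0.
split; first by rewrite -(mxrank_map iota) SE mxrank_scale_nz ?rank_symouter.
apply/exists_inPn => z; rewrite inE negbK -(fmorph_eq0 iota).
have -> : iota (dot (z *m S) z) = dot (map_mx iota z *m map_mx iota S) (map_mx iota z).
  by rewrite /dot map_trmx -!map_mxM [RHS]mxE.
rewrite SE -scalemxAr dotZl qf_symouter.
have fixz : map_mx (fun a => a ^+ #|F|) (map_mx iota z) = map_mx iota z.
  by apply/rowP => j; rewrite !mxE -rmorphXn expf_card.
have -> : dot (map_mx iota z) (conj_form F l) = dot (map_mx iota z) l ^+ #|F|.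
  by rewrite -(conj_dot iota) fixz.
rewrite mulf_eq0 (negPf ic0) mulf_eq0 -(rmorph_nat iota) fmorph_eq0 (negPf two0).
rewrite -exprS expf_eq0 /= => /eqP zl.
rewrite -(map_mx_eq0 iota) map_mxM SE -scalemxAr mulmx_symouter.
have -> : dot (map_mx iota z) (conj_form F l) = dot (map_mx iota z) l ^+ #|F|.
  by rewrite -(conj_dot iota) fixz.
rewrite zl expr0n (gtn_eqF (ltnW (finNzRing_gt1 F))).
by rewrite !scale0r addr0 scaler0.
Qed.

(** * Hessians of ternary quadratic forms *)

(** The matrix of second partial derivatives: the diagonal is doubled and the other entries are the
    coefficients themselves, so no division by 2 occurs. *)
Definition hessian (F : finFieldType) (a : 'rV[F]_6) : 'M[F]_3 :=
  \matrix_(i, j) (a 0 (sidx i j) *+ (i == j).+1).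

Lemma sidxC (i j : 'I_3) : sidx i j = sidx j i.
Proof.
by case: i j => [[|[|[|//]]] lt_i] [[|[|[|//]]] lt_j].
Qed.

Lemma hessian_sym (F : finFieldType) (a : 'rV[F]_6) : (hessian a)^T = hessian a.
Proof. by apply/matrixP => i j; rewrite !mxE sidxC eq_sym. Qed.

Lemma map_hessian (F L : finFieldType) (iota : {rmorphism F -> L})
    (a : 'rV[F]_6) : map_mx iota (hessian a) = hessian (map_mx iota a).
Proof. by apply/matrixP => i j; rewrite !mxE rmorphMn. Qed.

Lemma hessianZ (F : finFieldType) (c : F) (a : 'rV[F]_6) :
  hessian (c *: a) = c *: hessian a.
Proof. by apply/matrixP => i j; rewrite !mxE mulrnAr. Qed.

Lemma quadform_hessian (F : finFieldType) (a : 'rV[F]_6) :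
  2 *: quadform a = \sum_i \sum_j hessian a i j *: ('X_i * 'X_j).
Proof.
rewrite /quadform; under eq_bigr do rewrite big_mkcond /= sum_ord3.
rewrite [in RHS]sum_ord3 !(sum_ord3 (fun j : 'I_3 => _ *: _)) sum_ord3 /=.
rewrite !mxE /= (sidxC 1 0) (sidxC 2%:R 0) (sidxC 2%:R 1).
rewrite -!mul_mpolyC !mulr2n !mpolyCD; ring.
Qed.

Lemma linform_mul (R : comNzRingType) (l m : 'rV[R]_3) :
  2 *: (linform l * linform m)
    = \sum_i \sum_j symouter l m i j *: ('X_i * 'X_j).
Proof.
rewrite -[RHS]scale1r /linform !sum_ord3 !mxE !big_ord1 !mxE.
rewrite -!mul_mpolyC !mpolyCD !mpolyCM; ring.
Qed.

Lemma quadform_eval (F : finFieldType) (a : 'rV[F]_6) (x : 'rV[F]_3) :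
  2 * (quadform a).@[fun i => x 0 i] = dot (x *m hessian a) x.
Proof.
rewrite -mevalZ quadform_hessian exchange_big raddf_sum dotE.
apply: eq_bigr => j _; rewrite mxE mulr_suml raddf_sum.
by apply: eq_bigr => i _; rewrite /= mevalZ mevalM !mevalXU mulrA [_ * x _ i]mulrC.
Qed.

Lemma quadform_mderiv (F : finFieldType) (a : 'rV[F]_6) (x : 'rV[F]_3)
    (k : 'I_3) : 2 != 0 :> F ->
  (mderiv k (quadform a)).@[fun i => x 0 i] = (x *m hessian a) 0 k.
Proof.
move=> two0; apply: (mulfI two0); rewrite -mevalZ -mderivZ quadform_hessian.
have derX (i : 'I_3) : (mderiv k ('X_i : {mpoly F[3]})).@[fun i => x 0 i] = (i == k)%:R.
  rewrite mderivX mnm1E mevalZ; case: eqP => [->|_]; last by rewrite mul0r.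
  by rewrite -{1}[U_(k)%MM]add0m addmK mpolyX0 meval1 mulr1.
rewrite (raddf_sum (mderiv k)) (raddf_sum (meval _)) /= mxE.
under eq_bigr => i _.
  rewrite (raddf_sum (mderiv k)) (raddf_sum (meval _)) /=.
  under eq_bigr => j _.
    rewrite mderivZ mderivM mevalZ mevalD !mevalM !mevalXU !derX mulrDr.
    over.
  rewrite big_split /=; over.
rewrite big_split /= mulr_natl mulr2n; congr (_ + _).
  rewrite exchange_big /=; apply: eq_bigr => j _.
  rewrite (bigD1 k) //= big1 ?addr0 => [|i /negPf->]; last by rewrite mul0r mulr0.
  by rewrite eqxx mul1r -[in LHS]hessian_sym mxE mulrC.
apply: eq_bigr => i _.
rewrite (bigD1 k) //= big1 ?addr0 => [|j /negPf->]; last by rewrite !mulr0.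
by rewrite eqxx mulr1 mulrC.
Qed.

(** From polynomials to matrices only values are compared: a nonzero difference of the two matrices
    would be symmetric and so take a nonzero value. The lemma is also applied with L in place of
    F. *)
Lemma quadform_factorE (F : finFieldType) (a : 'rV[F]_6) (c : F)
    (l m : 'rV[F]_3) : 2 != 0 :> F ->
  (quadform a == c *: (linform l * linform m)) = (hessian a == c *: symouter l m).
Proof.
move=> two0; apply/eqP/eqP => [aE|aE].
  apply/eqP; rewrite -subr_eq0; apply/negPn/negP => S0.
  have symS : (hessian a - c *: symouter l m)^T = hessian a - c *: symouter l m.
    by rewrite linearB linearZ /= hessian_sym symouter_sym.
  have [v /eqP[]] := exists_nonisotropic two0 symS S0.
  rewrite mulmxBr dotDl -scaleN1r dotZl -quadform_eval aE -scalemxAr dotZl.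
  rewrite qf_symouter mevalZ mevalM.
  have linE (k : 'rV_3) : (linform k).@[fun i => v 0 i] = dot v k.
    rewrite dotE raddf_sum /=; apply: eq_bigr => i _.
    by rewrite mevalZ mevalXU mulrC.
  by rewrite !linE; ring.
have := quadform_hessian a; rewrite aE.
under eq_bigr do under eq_bigr do rewrite mxE -scalerA.
under eq_bigr do rewrite -scaler_sumr.
rewrite -scaler_sumr -linform_mul scalerA mulrC -scalerA.
move/(congr1 (fun p => 2^-1 *: p)).
by rewrite !scalerA mulrA mulVf // mul1r scale1r.
Qed.

Lemma map_quadform (F L : finFieldType) (iota : {rmorphism F -> L})
    (a : 'rV[F]_6) : map_mpoly iota (quadform a) = quadform (map_mx iota a).
Proof.
rewrite /quadform raddf_sum; apply: eq_bigr => i _.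
rewrite raddf_sum; apply: eq_bigr => j _.
by rewrite /= map_mpolyZ rmorphM /= !map_mpolyX mxE.
Qed.

Lemma double_lineE (F : finFieldType) (a : 'rV[F]_6) : 2 != 0 :> F ->
  is_double_line (quadform a) = (\rank (hessian a) == 1%N).
Proof.
move=> two0; have symE (l : 'rV[F]_3) : symouter l l = 2 *: (l^T *m l).
  by rewrite /symouter -mulr2n -scaler_nat.
apply/existsP/eqP => [[c /existsP[l /and3P[c0 l0]]]|].
  rewrite expr2 quadform_factorE // symE scalerA => /eqP->.
  rewrite mxrank_scale_nz ?mulf_neq0 //; apply/eqP; rewrite eqn_leq lt0n mxrank_eq0.
  rewrite (leq_trans (mxrankM_maxr _ _)) ?rank_leq_row //=.
  have [z zl] : exists z, dot l z != 0.
    have [j lj] : exists j, l 0 j != 0.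
      by have /matrix0Pn[i [j]] := l0; rewrite ord1; exists j.
    by exists (delta_mx 0 j); rewrite dot_delta.
  apply: contra l0 => /eqP/(congr1 (mulmx z)); rewrite mulmx_outer mulmx0 dotC.
  by move/eqP; rewrite scaler_eq0 (negPf zl).
case/(rank1_symmetric two0 (hessian_sym a)) => c [l [c0 l0 aE]].
exists (c / 2); apply/existsP; exists l.
rewrite mulf_neq0 ?invr_eq0 // l0 expr2 quadform_factorE // symE scalerA divfK //.
exact/eqP.
Qed.

Lemma real_line_pairE (F : finFieldType) (a : 'rV[F]_6) : 2 != 0 :> F ->
  is_real_line_pair (quadform a)
    = (\rank (hessian a) == 2%N) && has_regular_zero (hessian a).
Proof.
move=> two0; apply/existsP/andP => [[l /existsP[m /andP[free]]]|[/eqP rS reg]].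
  rewrite -[X in _ == X]scale1r quadform_factorE // scale1r => /eqP->.
  by rewrite rank_symouter // symouter_regular_zero.
have [l [m [free aE]]] := rank2_regular_zeroP two0 (hessian_sym a) rS reg.
exists l; apply/existsP; exists m; apply/andP; split=> //.
by rewrite -[X in _ == X]scale1r quadform_factorE // scale1r aE.
Qed.

Lemma imaginary_line_pairE (F L : finFieldType) (iota : {rmorphism F -> L})
    (a : 'rV[F]_6) : odd #|F| -> #|L| = (#|F| ^ 2)%N ->
  is_imaginary_line_pair iota (quadform a)
    = (\rank (hessian a) == 2%N) && ~~ has_regular_zero (hessian a).
Proof.
move=> oddF cardL; have two0L : 2 != 0 :> L.
  by rewrite -(rmorph_nat iota) fmorph_eq0 two_neq0.
apply/existsP/andP => [[c /existsP[l /and3P[c0 free]]]|[/eqP rS nreg]].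
  rewrite map_quadform quadform_factorE // -map_hessian => /eqP aE.
  by have [-> ->] := imaginary_rank2 oddF c0 free aE.
have [c [l [c0 free aE]]] :=
  rank2_imaginary iota oddF cardL (hessian_sym a) rS nreg.
exists c; apply/existsP; exists l; apply/and3P; split=> //.
by rewrite map_quadform quadform_factorE // -map_hessian aE.
Qed.

(** The gradient at u is u times the Hessian, and its pairing with u is twice the value, so the
    singular points are the nonzero kernel vectors. *)
Lemma nonsingularE (F : finFieldType) (a : 'rV[F]_6) : 2 != 0 :> F ->
  is_nonsingular (quadform a) = (\rank (hessian a) == 3%N).
Proof.
move=> two0; have singE u :
    is_singular_point (quadform a) u = (u != 0) && (u *m hessian a == 0).
  rewrite /is_singular_point; case: (u != 0) => //=.
  apply/andP/eqP => [[_ /forallP du]|ua0].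
    by apply/rowP => k; rewrite -quadform_mderiv // (eqP (du k)) mxE.
  split; last by apply/forallP => k; rewrite quadform_mderiv // ua0 mxE.
  by rewrite -(mulrI_eq0 _ (mulfI two0)) quadform_eval ua0 dot0l.
rewrite -[RHS]/(row_free _) -kermx_eq0.
apply/forallP/rowV0P => [ns u /sub_kermxP ua0|ker0 u].
  by apply/eqP; have := ns u; rewrite singE ua0 eqxx andbT negbK.
rewrite singE; apply/negP => /andP[u0 /eqP/sub_kermxP/ker0 uE].
by rewrite uE eqxx in u0.
Qed.

(** * Counting the forms through a point *)

Lemma sidxE : (sidx 0 0 = inord 0) * (sidx 0 1 = inord 1)
  * (sidx 0 2%:R = inord 2) * (sidx 1 1 = inord 3) * (sidx 1 2%:R = inord 4)
  * (sidx 2%:R 2%:R = inord 5) * (sidx 1 0 = inord 1)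
  * (sidx 2%:R 0 = inord 2) * (sidx 2%:R 1 = inord 4).
Proof. by []. Qed.

Lemma sum_ord6 (V : nmodType) (f : 'I_6 -> V) :
  \sum_i f i = f (inord 0) + f (inord 1) + f (inord 2) + f (inord 3)
                 + f (inord 4) + f (inord 5).
Proof.
rewrite !big_ord_recl big_ord0 addr0 !addrA.
by congr (f _ + f _ + f _ + f _ + f _ + f _); apply: val_inj; rewrite /= inordK.
Qed.

(** The trace counts off-diagonal products twice and the Hessian doubles the diagonal, hence the
    uniform factor 2. Incidence becomes orthogonality for the trace form. *)
Lemma trace_hessian_symmx (F : finFieldType) (a y : 'rV[F]_6) :
  \tr (hessian a *m symmx y) = 2 * dot a y.
Proof.
rewrite dotE sum_ord6 /mxtrace sum_ord3 !mxE !sum_ord3 !mxE !sidxE /=.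
ring.
Qed.

Lemma trace_outer (R : comPzRingType) (n : nat) (l m : 'rV[R]_n) (M : 'M_n) :
  \tr (l^T *m m *m M) = dot (m *m M) l.
Proof. by rewrite -mulmxA mxtrace_mulC trace_mx11. Qed.

Lemma symmx_sym (F : finFieldType) (y : 'rV[F]_6) : (symmx y)^T = symmx y.
Proof. by apply/matrixP => i j; rewrite !mxE sidxC. Qed.

Lemma symmx_veronese (F : finFieldType) (u : 'rV[F]_3) :
  symmx (veronese u) = u^T *m u.
Proof.
have uE : (u 0 (inord 0) = u 0 0) * (u 0 (inord 1) = u 0 1)
    * (u 0 (inord 2) = u 0 2%:R).
  by do !split; congr (u 0 _); apply: val_inj; rewrite /= inordK.
apply/matrixP => i j; rewrite outerE mxE.
have [-> ->] : i = inord i /\ j = inord j by rewrite !inord_val.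
case: i j => [[|[|[|//]]] lt_i] [[|[|[|//]]] lt_j] /=;
  by rewrite /sidx !mxE !inordK //= !uE ?expr2 // mulrC.
Qed.

(** Being a zero of a is thus a linear condition on a, which makes the pairs (a, x) countable from
    the side of x. *)
Lemma dot_veronese (F : finFieldType) (a : 'rV[F]_6) (u : 'rV[F]_3) :
  2 * dot a (veronese u) = dot (u *m hessian a) u.
Proof.
by rewrite -trace_hessian_symmx symmx_veronese mxtrace_mulC trace_outer.
Qed.

Lemma hessian_inj (F : finFieldType) : 2 != 0 :> F -> injective (@hessian F).
Proof.
move=> two0 a b eqab; apply: dot_inj => y; apply: (mulfI two0).
by rewrite -!trace_hessian_symmx eqab.
Qed.

Lemma symmetric_hessian (F : finFieldType) (W : 'M[F]_3) :
  2 != 0 :> F -> W^T = W -> exists a, hessian a = W.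
Proof.
move=> two0 symW.
exists (\row_k nth 0 [:: W 0 0 / 2; W 0 1; W 0 2%:R; W 1 1 / 2; W 1 2%:R;
                         W 2%:R 2%:R / 2] k).
apply/matrixP => i j; rewrite !mxE.
have WC k l : W k l = W l k by rewrite -[in LHS]symW mxE.
have iE (k : 'I_3) : [\/ k = 0, k = 1 | k = 2%:R].
  case: k => [[|[|[|//]]] lt_k]; [apply: Or31|apply: Or32|apply: Or33];
  exact: val_inj.
case: (iE i) => ->; case: (iE j) => ->; rewrite sidxE inordK //=.
all: by rewrite -[LHS]mulr_natr divfK.
Qed.

Lemma exists_dot1 (F : fieldType) (n : nat) (l : 'rV[F]_n) :
  l != 0 -> exists z, dot z l = 1.
Proof.
move=> /matrix0Pn[i [j]]; rewrite ord1 => lj; exists ((l 0 j)^-1 *: delta_mx 0 j).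
by rewrite dotZl dotC dot_delta mulVf.
Qed.

(** With a.z = 1, the vector v - (a.v) z lies in the common hyperplane, so b.v = (a.v)(b.z). *)
Lemma form_hyperplane_inj (F : finFieldType) (a b : 'rV[F]_6) : a != 0 ->
  form_hyperplane a = form_hyperplane b -> exists c, b = c *: a.
Proof.
move=> a0 eqH; have [z za] := exists_dot1 a0.
exists (dot b z); apply: dot_inj => v; rewrite dotZl.
have : v - dot a v *: z \in form_hyperplane b.
  rewrite -eqH inE -dotE dotDr -scaleNr dotZr [dot a z]dotC za mulr1.
  by rewrite subrr.
by rewrite inE -dotE dotDr -scaleNr dotZr mulNr subr_eq0 mulrC => /eqP.
Qed.

Lemma rowspace_sub_hyperplane (F : finFieldType) (a y : 'rV[F]_6) :
  (rowspace y \subset form_hyperplane a) = (dot a y == 0).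
Proof.
apply/subsetP/eqP => [sub|ay v].
  by apply/eqP; have := sub y; rewrite !inE submx_refl -dotE; apply.
by rewrite !inE => /sub_rVP[k ->]; rewrite -dotE dotZr ay mulr0.
Qed.

Definition annihilators (F : finFieldType) (t : pred 'M[F]_3) (y : 'rV[F]_6) :
  {set 'rV[F]_6} := [set a | [&& a != 0, t (hessian a) & dot a y == 0]].

(** The vectors defining a given hyperplane are the q - 1 nonzero multiples of one of them, all in
    the same class since t is invariant under scaling. *)
Lemma card_annihilators (F : finFieldType) (p : pred {mpoly F[3]})
    (t : pred 'M[F]_3) (y : 'rV[F]_6) :
    (forall a, p (quadform a) = t (hessian a)) ->
    (forall c W, c != 0 -> t (c *: W) = t W) ->
  #|annihilators t y| = (containing (rowspace y) (hyperplanes_of p) * #|F|.-1)%N.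
Proof.
move=> pt tZ; rewrite (@card_fibers _ _ (@form_hyperplane F) _ #|F|.-1).
  congr muln; apply: eq_card => H; rewrite inE.
  apply/imsetP/andP => [[a + ->]|[/imsetP[a + ->]]].
    rewrite inE => /and3P[a0 ta ay]; rewrite rowspace_sub_hyperplane; split=> //.
    by apply/imsetP; exists a; rewrite // inE a0 pt.
  rewrite inE => /andP[a0 pa]; rewrite rowspace_sub_hyperplane => ay.
  by exists a; rewrite // inE a0 -pt pa.
move=> a; rewrite inE => /and3P[a0 ta ay].
rewrite -(cardsC1 (0 : F)) -(card_imset _ (f := fun c => c *: a)); last first.
  move=> c d /eqP; rewrite -subr_eq0 -scalerBl scaler_eq0 (negPf a0) orbF.
  by rewrite subr_eq0 => /eqP.
apply: eq_card => b; rewrite !inE; apply/andP/imsetP => [[/and3P[b0 _ _]]|].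
  move/eqP/esym/(form_hyperplane_inj a0) => [c bE]; exists c => //.
  by rewrite !inE; apply: contra b0 => /eqP c0; rewrite bE c0 scale0r.
case=> c; rewrite !inE => c0 ->; rewrite hessianZ tZ // ta dotZl (eqP ay) mulr0.
rewrite scaler_eq0 (negPf c0) (negPf a0) eqxx; split=> //; apply/eqP/setP => v.
by rewrite !inE -!dotE dotZl mulf_eq0 (negPf c0).
Qed.

(** Transports the count to symmetric matrices orthogonal to M for the trace form; [~~ t 0] accounts
    for the condition [a != 0]. *)
Lemma card_hessian_image (F : finFieldType) (t : pred 'M[F]_3) (y : 'rV[F]_6)
    (WW : {set 'M[F]_3}) : 2 != 0 :> F -> ~~ t 0 ->
    (forall W, W \in WW = [&& W^T == W, t W & \tr (W *m symmx y) == 0]) ->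
  #|annihilators t y| = #|WW|.
Proof.
move=> two0 t0 WWE; rewrite -(card_imset _ (hessian_inj two0)).
apply: eq_card => W; rewrite WWE; apply/imsetP/and3P => [[a + ->]|].
  rewrite inE trace_hessian_symmx mulf_eq0 (negPf two0) hessian_sym.
  by case/and3P.
case=> /eqP/(symmetric_hessian two0)[a <-] ta.
rewrite trace_hessian_symmx mulf_eq0 (negPf two0) /= => ay.
exists a; rewrite // inE ta ay !andbT; apply: contra t0 => /eqP a0.
by move: ta; rewrite a0 -(scale0r (0 : 'rV[F]_6)) hessianZ scale0r.
Qed.

(** The pairs in question are (c / t^2, t l) with t nonzero. *)
Lemma card_outer_fiber (F : finFieldType) (n : nat) (c : F) (l : 'rV[F]_n) :
    c != 0 -> l != 0 ->
  #|[set p : F * 'rV_n | p.1 *: (p.2^T *m p.2) == c *: (l^T *m l)]| = #|F|.-1.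
Proof.
move=> c0 l0; have [z zl] := exists_dot1 l0.
rewrite -(cardsC1 (0 : F)).
rewrite -(card_imset _ (f := fun t => (c / t ^+ 2, t *: l))); last first.
  move=> s t [_ /eqP]; rewrite -subr_eq0 -scalerBl scaler_eq0 (negPf l0) orbF.
  by rewrite subr_eq0 => /eqP.
apply: eq_card => -[c' l']; rewrite !inE /=; apply/eqP/imsetP => [e|].
  have e1 : (c' * dot z l') *: l' = c *: l.
    by have := congr1 (mulmx z) e; rewrite -!scalemxAr !mulmx_outer !scalerA zl mulr1.
  have e2 : c' * dot z l' ^+ 2 = c.
    have := congr1 (dot z) e1; rewrite !dotZr zl mulr1 => <-; ring.
  have d0 : dot z l' != 0.
    by apply: contra c0 => /eqP d0; rewrite -e2 d0 expr0n mulr0.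
  exists (dot z l'); rewrite ?inE //; congr pair; first by rewrite -e2 mulfK ?expf_neq0.
  apply: (scalerI (a := c' * dot z l')).
    by apply: contra c0 => /eqP d1; rewrite -e2 expr2 mulrA d1 mul0r.
  by rewrite e1 scalerA -mulrA -expr2 e2.
case=> t; rewrite !inE => t0 [-> ->]; rewrite !linearZ /= -scalemxAl.
by rewrite !scalerA mulrC mulrA -expr2 mulrC divfK ?expf_neq0.
Qed.

(** There are (q - 1)(N - 1) pairs (c, l) with c nonzero and l a nonzero isotropic vector, and each
    matrix comes from q - 1 of them; the successor accounts for l = 0. *)
Lemma card_rank1_annihilators (F : finFieldType) (y : 'rV[F]_6) : odd #|F| ->
  (#|annihilators (fun W => \rank W == 1%N) y|).+1 = #|isotropic (symmx y)|.
Proof.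
move=> oddF; have two0 := two_neq0 oddF; set M := symmx y.
pose A := [set p : F * 'rV_3 | (p.1 != 0) && (p.2 \in isotropic M :\ 0)].
pose f (p : F * 'rV_3) := p.1 *: (p.2^T *m p.2).
have trf p : \tr (f p *m M) = p.1 * dot (p.2 *m M) p.2.
  by rewrite -scalemxAl linearZ /= trace_outer.
have rankf p : p.1 != 0 -> p.2 != 0 -> \rank (f p) = 1%N.
  move=> c0 l0; rewrite mxrank_scale_nz //; apply/eqP; rewrite eqn_leq lt0n mxrank_eq0.
  rewrite (leq_trans (mxrankM_maxr _ _)) ?rank_leq_row //=.
  have [z zl] := exists_dot1 l0; apply: contra l0 => /eqP/(congr1 (mulmx z)).
  by rewrite mulmx_outer mulmx0 zl scale1r => ->.
rewrite (@card_hessian_image _ _ _ (f @: A)) ?mxrank0 //; last first.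
  move=> W; apply/imsetP/and3P => [[p + ->]|[/eqP symW /eqP rW trW]].
    rewrite !inE => /and3P[c0 l0 iso]; rewrite rankf // trf (eqP iso) mulr0.
    by split=> //; rewrite linearZ /= trmx_mul trmxK.
  have [c [l [c0 l0 WE]]] := rank1_symmetric two0 symW rW.
  exists (c, l) => //; rewrite !inE /= c0 l0 /=.
  by move: trW; rewrite WE (trf (c, l)) mulf_eq0 (negPf c0).
have cardA : #|A| = (#|F|.-1 * #|isotropic M :\ 0%R|)%N.
  by rewrite -(cardsC1 (0 : F)) -cardsX; apply: eq_card => p; rewrite !inE.
have zero_iso : 0 \in isotropic M by rewrite inE mul0mx dot0l.
rewrite (cardsD1 0 (isotropic M)) zero_iso add1n; congr S.
have q1 : (0 < #|F|.-1)%N by rewrite -subn1 subn_gt0 finNzRing_gt1.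
apply/eqP; rewrite -(eqn_pmul2r q1) [X in _ == X]mulnC -cardA; apply/eqP/esym.
apply: card_fibers.
move=> p pA; have := pA; rewrite !inE => /and3P[c0 l0 iso].
rewrite -[RHS](card_outer_fiber c0 l0); apply: eq_card => p'; rewrite inE [RHS]inE.
(* The whole fiber lies in A: the image has rank 1, so both factors are nonzero, and the trace makes
   the vector isotropic. *)
rewrite andb_idl // => /eqP fE.
have := rankf _ c0 l0; rewrite -fE !inE => rf'.
have c'0 : p'.1 != 0.
  by apply/eqP => c'0; move: rf'; rewrite /f c'0 scale0r mxrank0.
have l'0 : p'.2 != 0.
  by apply/eqP => l'0; move: rf'; rewrite /f l'0 mulmx0 scaler0 mxrank0.
rewrite c'0 l'0 /=; have := trf p'.
by rewrite fE trf (eqP iso) mulr0 => /esym/eqP; rewrite mulf_eq0 (negPf c'0).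
Qed.

Lemma row_free_col_mx (F : fieldType) (n : nat) (l m : 'rV[F]_n) :
  l != 0 -> row_free (col_mx l m) = ~~ (m <= l)%MS.
Proof.
move=> l0; apply/idP/idP => [/row_free2P[z [w [_ _ wl wm]]]|nml].
  apply/negP => /sub_rVP[c mE]; move/eqP: wm.
  by rewrite mE dotZr wl mulr0 eq_sym oner_eq0.
have : (l < col_mx l m)%MS.
  rewrite /ltmx; apply/andP; split.
    by have := submx_refl (col_mx l m); rewrite {1}col_mx_sub => /andP[].
  by rewrite col_mx_sub negb_and nml orbT.
move/rank_ltmx; rewrite [X in (X < _)%N](_ : _ = 1%N); last first.
  by apply/eqP; rewrite eqn_leq rank_leq_row lt0n mxrank_eq0.
by rewrite /row_free eqn_leq rank_leq_row.
Qed.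

Lemma card_rowspace (F : finFieldType) (m n : nat) (A : 'M[F]_(m, n)) :
  #|rowspace A| = (#|F| ^ \rank A)%N.
Proof.
by rewrite -card_rowg; apply: eq_card => x; rewrite !mem_rowg.
Qed.

(* A symmetric product of two independent vectors determines them up to order
   and reciprocal scalars. *)
Lemma card_symouter_fiber (F : finFieldType) (n : nat) (l m : 'rV[F]_n) :
    2 != 0 :> F -> row_free (col_mx l m) ->
  #|[set p : 'rV_n * 'rV_n | symouter p.1 p.2 == symouter l m]|
    = (2 * #|F|.-1)%N.
Proof.
move=> two0 free; have [z [w [zl zm wl wm]]] := row_free2P free.
have split_factors (l' m' k h u v : 'rV[F]_n) : symouter l' m' = symouter k h ->
    dot u k = 1 -> dot u h = 0 -> dot v k = 0 -> dot v h = 1 -> dot u l' = 0 ->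
  exists2 t, t != 0 & l' = t *: h /\ m' = t^-1 *: k.
  move=> e uk uh vk vh ul.
  have := congr1 (mulmx u) e; have := congr1 (mulmx v) e.
  rewrite !mulmx_symouter uk uh vk vh ul !scale0r scale1r !add0r scale1r addr0.
  move=> ev eu; have t0 : dot u m' != 0.
    apply/eqP => um; move/eqP: vh; rewrite -eu um scale0r dotC dot0l eq_sym.
    by rewrite oner_eq0.
  have l'E : l' = (dot u m')^-1 *: h by rewrite -eu scalerA mulVf // scale1r.
  have vm : dot v m' = 0.
    have := congr1 (dot v) ev; rewrite dotDr !dotZr l'E dotZr vh vk mulr1.
    move/eqP; rewrite [dot v m' * _]mulrC -mulr2n -mulr_natl !mulf_eq0.
    by rewrite (negPf two0) invr_eq0 (negPf t0) => /eqP.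
  exists (dot u m')^-1; first by rewrite invr_eq0.
  split=> //; rewrite invrK -ev vm scale0r addr0 l'E dotZr vh mulr1 scalerA.
  by rewrite mulfV // scale1r.
pose f (x : bool * F) : 'rV_n * 'rV_n :=
  if x.1 then (x.2 *: l, x.2^-1 *: m) else (x.2 *: m, x.2^-1 *: l).
have injf : {in [set x : bool * F | x.2 != 0] &, injective f}.
  move=> [b s] [c t]; rewrite !inE /= => s0 t0 e.
  have := congr1 (fun p => dot z p.1) e; have := congr1 (fun p => dot w p.1) e.
  rewrite /f /=; case: b c {e} => [] [] /=; rewrite !dotZr ?zl ?zm ?wl ?wm;
    rewrite ?mulr0 ?mulr1 => e1 e2; rewrite ?e1 ?e2 //;
    by rewrite ?e1 ?e2 -?e1 -?e2 eqxx in s0 t0.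
have -> : (2 * #|F|.-1)%N = #|[set x : bool * F | x.2 != 0]|.
  rewrite -card_bool -(cardsC1 (0 : F)) -cardsT -cardsX.
  by apply: eq_card => x; rewrite !inE.
rewrite -(card_in_imset injf); apply: eq_card => -[l' m']; rewrite inE /=.
apply/eqP/imsetP => [e|[[b t]]]; last first.
  rewrite inE /f /=; case: b => t0 [-> ->]; rewrite symouterZZ mulfV // scale1r //.
  exact: symouterC.
have := congr1 (fun A => dot (z *m A) z) e.
rewrite !qf_symouter zm !mulr0 => /eqP.
rewrite !mulf_eq0 (negPf two0) /= => /orP[/eqP zl'|/eqP zm'].
  have [t t0 [-> ->]] := split_factors _ _ _ _ _ _ e zl zm wl wm zl'.
  by exists (false, t); rewrite ?inE.
move: e; rewrite symouterC => e.
have [t t0 [-> ->]] := split_factors _ _ _ _ _ _ e zl zm wl wm zm'.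
by exists (true, t^-1); rewrite ?inE /f /= ?invr_eq0 ?invrK.
Qed.

(** Both sides count the pairs (l, m) with l M m^T = 0. On the right, m is arbitrary if l lies in
    the kernel and ranges over a 2-dimensional space otherwise. On the left, independent pairs come
    2 (q - 1) to a matrix; the dependent ones are l = 0 with any m, a nonzero isotropic l with its q
    multiples, and a non-isotropic l with m = 0. *)
Lemma card_rank2_regular_annihilators (F : finFieldType) (y : 'rV[F]_6)
    (iso := isotropic (symmx y)) (ker := [set x : 'rV_3 | x *m symmx y == 0]) :
    odd #|F| ->
  (#|annihilators (fun W => (\rank W == 2%N) && has_regular_zero W) y|
       * (2 * #|F|.-1) + (#|F| ^ 3 + #|iso :\ 0%R| * #|F| + #|~: iso|)
     = #|ker| * #|F| ^ 3 + #|~: ker| * #|F| ^ 2)%N.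
Proof.
move=> oddF; have two0 := two_neq0 oddF; set M := symmx y.
pose f (p : 'rV[F]_3 * 'rV[F]_3) := symouter p.1 p.2.
pose perp := [set p : 'rV[F]_3 * 'rV[F]_3 | dot (p.1 *m M) p.2 == 0].
pose free := [set p : 'rV[F]_3 * 'rV[F]_3 | row_free (col_mx p.1 p.2)].
have trf p : \tr (f p *m M) = 2 * dot (p.1 *m M) p.2.
  rewrite /f /symouter mulmxDl mxtraceD !trace_outer [dot (p.2 *m _) _]dotwC.
    by rewrite -mulr2n mulr_natl.
  exact: symmx_sym.
rewrite (@card_hessian_image _ _ _ (f @: (perp :&: free))) ?mxrank0 //; last first.
  move=> W; apply/imsetP/and3P => [[p + ->]|[/eqP symW /andP[/eqP rW reg] trW]].
    rewrite !inE => /andP[/eqP perp_p free_p]; rewrite symouter_sym trf perp_p mulr0.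
    by rewrite rank_symouter // symouter_regular_zero.
  have [l [m [free_lm WE]]] := rank2_regular_zeroP two0 symW rW reg.
  exists (l, m) => //; rewrite !inE free_lm andbT.
  by move: trW; rewrite WE (trf (l, m)) mulf_eq0 (negPf two0).
rewrite -(@card_fibers _ _ f (perp :&: free)); last first.
  move=> p; rewrite !inE => /andP[perp_p free_p].
  rewrite -[RHS](card_symouter_fiber two0 free_p); apply: eq_card => p'.
  rewrite !inE andb_idl // => /eqP fE; apply/andP; split.
    by rewrite -(mulrI_eq0 _ (mulfI two0)) -trf fE trf (eqP perp_p) mulr0.
  (* The image, of rank 2, factors through the pair, which is therefore independent. *)
  rewrite /row_free eqn_leq rank_leq_row /=.
  apply: (@leq_trans (\rank (f p'))); first by rewrite fE rank_symouter.
  by rewrite /f /symouter addrC -mul_row_col mxrankM_maxr.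
have cardV : #|{: 'rV[F]_3}| = (#|F| ^ 3)%N by rewrite card_mx.
have <- : #|perp| = (#|ker| * #|F| ^ 3 + #|~: ker| * #|F| ^ 2)%N.
  rewrite /perp (card_pairs (fun l m => dot (l *m M) m == 0)).
  rewrite (bigID (mem ker)) /= -!sum_nat_const; congr addn.
    apply: eq_bigr => l; rewrite inE => /eqP lM; rewrite -cardV -cardsT.
    by apply: eq_card => m; rewrite !inE lM dot0l eqxx.
  apply: eq_big => [l|l]; first by rewrite !inE.
  rewrite inE => lM0; have := card_kernel (l *m M)^T.
  rewrite [\rank _](_ : _ = 1%N); last first.
    apply/eqP.
    by rewrite mxrank_tr eqn_leq rank_leq_row lt0n mxrank_eq0.
  move=> <-; apply: eq_card => m; rewrite !inE dotC.
  rewrite [m *m _]mx11_scalar -scalemx1 scaler_eq0.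
  by rewrite (negPf (matrix_nonzero1 _ _)) orbF.
rewrite -(cardsID free perp); congr addn; apply/esym.
have zero_iso : 0 \in iso by rewrite inE mul0mx dot0l.
have -> : #|perp :\: free| = (\sum_(l : 'rV[F]_3) #|[set m : 'rV[F]_3 |
    ~~ row_free (col_mx l m) && (dot (l *m M)%R m == 0%R)]|)%N.
  rewrite -(card_pairs (fun l m => ~~ row_free (col_mx l m) && _)).
  by apply: eq_card => p; rewrite !inE.
rewrite (bigD1 0) //= -addnA; congr addn.
  rewrite -cardV -cardsT; apply: eq_card => m; rewrite !inE mul0mx dot0l eqxx.
  rewrite andbT; apply/negP => /row_free2P[z [w [zl _ _ _]]].
  by move/eqP: zl; rewrite dotC dot0l eq_sym oner_eq0.
rewrite (bigID (mem iso)) /= -sum_nat_const -[#|~: iso|]sum1_card; congr addn.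
  apply: eq_big => [l|l /andP[l0 l_iso]]; first by rewrite !inE.
  have := card_rowspace l; rewrite [\rank l](_ : _ = 1%N); last first.
    by apply/eqP; rewrite eqn_leq rank_leq_row lt0n mxrank_eq0.
  rewrite expn1 => <-; apply: eq_card => m; rewrite !inE row_free_col_mx //.
  rewrite negbK andb_idr // => /sub_rVP[c ->]; move: l_iso; rewrite inE => /eqP e.
  by rewrite dotZr e mulr0.
apply: eq_big => [l|l /andP[l0 l_niso]].
  by rewrite !inE andb_idl //; apply: contraNneq => ->; rewrite mul0mx dot0l.
transitivity #|[set 0 : 'rV[F]_3]|; last exact: cards1.
apply: eq_card => m; rewrite !inE.
rewrite row_free_col_mx // negbK; apply/andP/eqP => [[/sub_rVP[c ->]]|->].
  rewrite dotZr mulf_eq0; move: l_niso; rewrite inE => /negPf->; rewrite orbF.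
  by move/eqP->; rewrite scale0r.
by rewrite sub0mx dotC dot0l.
Qed.

(** * Double count of forms and their zeros *)

Lemma card_perp (F : finFieldType) (n : nat) (y : 'rV[F]_n) :
  y != 0 -> #|[set a | dot a y == 0]| = (#|F| ^ n.-1)%N.
Proof.
move=> y0; have := card_kernel y^T.
rewrite [\rank _](_ : _ = 1%N) ?subn1 => [<-|]; last first.
  by apply/eqP; rewrite mxrank_tr eqn_leq rank_leq_row lt0n mxrank_eq0.
apply: eq_card => a; rewrite !inE [a *m _]mx11_scalar -scalemx1 scaler_eq0.
by rewrite (negPf (matrix_nonzero1 _ _)) orbF.
Qed.

(** If v is not a multiple of y, the vectors orthogonal to both form the kernel of the rank-2 matrix
    [symouter y v]. *)
Lemma card_perp2 (F : finFieldType) (n : nat) (y v : 'rV[F]_n) : y != 0 ->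
  #|[set a | (dot a y == 0) && (dot a v == 0)]|
    = (#|F| ^ (if (v <= y)%MS then n.-1 else n - 2))%N.
Proof.
move=> y0; case: ifPn => [/sub_rVP[c ->]|nvy].
  rewrite -(card_perp y0); apply: eq_card => a; rewrite !inE andb_idr // dotZr.
  by move/eqP->; rewrite mulr0.
have := row_free_col_mx v y0; rewrite nvy => free.
have := card_kernel (symouter y v); rewrite rank_symouter // => <-.
have [z [w [zy zv wy wv]]] := row_free2P free.
apply: eq_card => a; rewrite !inE mulmx_symouter.
apply/andP/eqP => [[/eqP-> /eqP->]|e]; first by rewrite !scale0r addr0.
have := congr1 (dot z) e; have := congr1 (dot w) e.
rewrite !dotDr !dotZr zy zv wy wv ![dot _ 0]dotC !dot0l !mulr0 !mulr1 add0r addr0.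
by move=> -> ->.
Qed.

Lemma hessian0 (F : finFieldType) : hessian (0 : 'rV[F]_6) = 0.
Proof. by apply/matrixP => i j; rewrite !mxE mul0rn. Qed.

(** For fixed x, the vectors a are those orthogonal to y and to the Veronese image of x: two
    independent conditions, or a single one when x is in E. *)
Lemma sum_card_isotropic (F : finFieldType) (y : 'rV[F]_6)
    (E := [set x | (veronese x <= y)%MS]) : odd #|F| -> y != 0 ->
  (\sum_(a in [set a | dot a y == 0%R]) #|isotropic (hessian a)|
     = #|E| * #|F| ^ 5 + #|~: E| * #|F| ^ 4)%N.
Proof.
move=> oddF y0; have two0 := two_neq0 oddF.
under eq_bigr do rewrite -sum1_card.
rewrite (exchange_big_dep xpredT) //= (bigID (mem E)) /= -!sum_nat_const.
have inner x : (\sum_(a | (a \in [set a | dot a y == 0%R])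
                          && (x \in isotropic (hessian a))) 1
    = #|F| ^ (if (veronese x <= y)%MS then 5 else 4))%N.
  rewrite -(card_perp2 (veronese x) y0) -sum1_card; apply: eq_bigl => a.
  by rewrite !inE -dot_veronese mulf_eq0 (negPf two0).
congr addn; apply: eq_big => x; rewrite ?inE // => xE.
  by rewrite inner xE.
by rewrite inner (negPf xE).
Qed.

(** Indicators over one index set let the identities below be checked form by form. *)
Lemma annihilators_sum (F : finFieldType) (t : pred 'M[F]_3) (y : 'rV[F]_6) :
  #|annihilators t y|%:R
    = \sum_(a in [set a | dot a y == 0]) ((a != 0) && t (hessian a))%:R :> rat.
Proof.
rewrite -natr_sum -big_mkcondr /= sum1_card; congr _%:R; apply: eq_card => a.
by rewrite !inE [RHS]andbC -andbA inE.
Qed.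

Lemma hessian_eq0 (F : finFieldType) (a : 'rV[F]_6) :
  2 != 0 :> F -> (\rank (hessian a) == 0%N) = (a == 0).
Proof.
move=> two0; rewrite mxrank_eq0 -(inj_eq (hessian_inj two0)).
by rewrite hessian0.
Qed.

(** * Linear equations for the four counts *)

Section Totals.
Variables (F : finFieldType) (y : 'rV[F]_6).
Hypotheses (oddF : odd #|F|) (y0 : y != 0).
Let q : rat := #|F|%:R.
Let n1 : rat := #|annihilators (fun W => \rank W == 1%N) y|%:R.
Let n2r : rat :=
  #|annihilators (fun W => (\rank W == 2%N) && has_regular_zero W) y|%:R.
Let n2i : rat :=
  #|annihilators (fun W => (\rank W == 2%N) && ~~ has_regular_zero W) y|%:R.
Let n3 : rat := #|annihilators (fun W => \rank W == 3%N) y|%:R.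

Lemma sum_zero_form : \sum_(a in [set a | dot a y == 0]) (a == 0)%:R = 1 :> rat.
Proof.
rewrite (bigD1 0) /=; last by rewrite inE dot0l.
by rewrite eqxx big1 ?addr0 // => a /andP[_ /negPf->].
Qed.

(** The summand 1 is the zero form. *)
Lemma annihilators_total : 1 + n1 + n2r + n2i + n3 = q ^+ 5.
Proof.
rewrite -natrX -(card_perp y0) -[in RHS]sum1_card natr_sum /n1 /n2r /n2i /n3.
rewrite !annihilators_sum -{1}sum_zero_form -!big_split; apply: eq_bigr => a _ /=.
rewrite -(hessian_eq0 a (two_neq0 oddF)).
have := rank_leq_row (hessian a); case: (has_regular_zero (hessian a)).
  by case: (\rank _) => [|[|[|[|//]]]] _; rewrite /= !(add0r, addr0).
by case: (\rank _) => [|[|[|[|//]]]] _; rewrite /= !(add0r, addr0).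
Qed.

(** Relative to the value q^2 of double lines and non-singular conics, a real pair has q^2 - q zeros
    more, an imaginary pair as many fewer, and the zero form q^3 - q^2 more; q^7 is that value
    summed over q^5 forms. *)
Lemma annihilators_zeros (e := #|[set x | (veronese x <= y)%MS]|%:R : rat) :
  q ^+ 7 + (q ^+ 2 - q) * (n2r - n2i) + (q ^+ 3 - q ^+ 2)
    = e * q ^+ 5 + (q ^+ 3 - e) * q ^+ 4.
Proof.
have two0 := two_neq0 oddF.
have card_iso (a : 'rV[F]_6) : (#|isotropic (hessian a)|%:R : rat)
    = q ^+ 2 + (q ^+ 2 - q)
          * (((a != 0) && ((\rank (hessian a) == 2%N)
                           && has_regular_zero (hessian a)))%:R
             - ((a != 0) && ((\rank (hessian a) == 2%N)
                             && ~~ has_regular_zero (hessian a)))%:R)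
      + (q ^+ 3 - q ^+ 2) * (a == 0)%:R.
  rewrite -(hessian_eq0 a two0).
  have [r0|r0] := eqVneq (\rank (hessian a)) 0%N.
    have /eqP -> : hessian a == 0 by rewrite -mxrank_eq0 r0.
    rewrite (_ : isotropic 0 = setT) ?cardsT ?card_mx ?natrX /=; last first.
      by apply/setP => x; rewrite !inE mulmx0 dot0l eqxx.
    by rewrite /q; ring.
  have [r1|r1] := eqVneq (\rank (hessian a)) 1%N.
    rewrite card_isotropic_singular ?rank1_no_regular_zero ?hessian_sym //.
    by rewrite r1 natrX /= /q; ring.
  have [r2|r2] := eqVneq (\rank (hessian a)) 2%N.
    case: (boolP (has_regular_zero (hessian a))) => reg.
      have [l [m [free aE]]] := rank2_regular_zeroP two0 (hessian_sym a) r2 reg.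
      have /(congr1 (fun n => n%:R : rat)) := card_isotropic_symouter two0 free.
      rewrite -aE natrD natrM !natrX => e2.
      by rewrite -[LHS](addrK (#|F|%:R ^+ (3 - 2))) e2 /= /q; ring.
    by rewrite card_isotropic_singular // r2 natrX /= /q; ring.
  have r3 : \rank (hessian a) = 3%N.
    by have := rank_leq_row (hessian a); case: (\rank _) r0 r1 r2 => [|[|[|[|]]]].
  by rewrite card_isotropic_rank3 ?hessian_sym // natrX /= /q; ring.
have -> : e * q ^+ 5 + (q ^+ 3 - e) * q ^+ 4
    = \sum_(a in [set a | dot a y == 0]) #|isotropic (hessian a)|%:R.
  rewrite -natr_sum sum_card_isotropic // [RHS]natrD [X in _ = X + _]natrM.
  rewrite [X in _ = _ + X]natrM !natrX -/q -/e; congr (_ + _ * _).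
  apply/eqP; rewrite subr_eq addrC -natrD cardsC card_mx natrX.
  exact/eqP.
under [RHS]eq_bigr do rewrite card_iso.
rewrite !big_split /= -!mulr_sumr sum_zero_form sumrB.
rewrite /n2r /n2i !annihilators_sum sumr_const (card_perp y0) -mulr_natr natrX -/q.
by ring.
Qed.

Lemma annihilators_rank1 (N := #|isotropic (symmx y)|%:R : rat) : n1 + 1 = N.
Proof. by rewrite /N -card_rank1_annihilators // -addn1 natrD. Qed.

Lemma annihilators_rank2_regular (N := #|isotropic (symmx y)|%:R : rat)
    (K := q ^+ (3 - \rank (symmx y))) :
  2 * (q - 1) * n2r + q ^+ 3 + (N - 1) * q + (q ^+ 3 - N)
    = K * q ^+ 3 + (q ^+ 3 - K) * q ^+ 2.
Proof.
have cardC (A : {set 'rV[F]_3}) : #|~: A|%:R = q ^+ 3 - #|A|%:R :> rat.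
  apply/eqP; rewrite eq_sym subr_eq addrC -natrD cardsC card_mx natrX.
  exact/eqP.
have q1 : #|F|.-1%:R = q - 1.
  by rewrite -subn1 natrB // ltnW // finNzRing_gt1.
have N1 : #|isotropic (symmx y) :\ 0|%:R = N - 1.
  by rewrite /N (cardsD1 0 (isotropic _)) inE mul0mx dot0l eqxx natrD addrC addKr.
have KE : #|[set x : 'rV_3 | x *m symmx y == 0]|%:R = K.
  by rewrite card_kernel natrX.
have cast (n u v w k kc c s2 s3 : nat) :
    (n * (2 * u) + (s3 + v * c + w) = k * s3 + kc * s2)%N ->
  n%:R * (2 * u%:R) + (s3%:R + v%:R * c%:R + w%:R)
    = k%:R * s3%:R + kc%:R * s2%:R :> rat.
  by move/(congr1 (fun n => n%:R : rat)); rewrite !natrD !natrM.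
have := cast _ _ _ _ _ _ _ _ _ (card_rank2_regular_annihilators y oddF).
rewrite !cardC q1 N1 KE !natrX -/q -/n2r -/N => <-.
by ring.
Qed.

End Totals.

(** * Veronese vectors proportional to a given point *)

Lemma symmxD (F : finFieldType) : {morph @symmx F : y v / y + v}.
Proof. by move=> y v; apply/matrixP => i j; rewrite !mxE. Qed.

Lemma symmxZ (F : finFieldType) (c : F) (y : 'rV[F]_6) :
  symmx (c *: y) = c *: symmx y.
Proof. by apply/matrixP => i j; rewrite !mxE. Qed.

Lemma symmx_inj (F : finFieldType) : 2 != 0 :> F -> injective (@symmx F).
Proof.
move=> two0 y v eqyv; apply: dot_inj => a; apply: (mulfI two0).
by rewrite ![dot _ a]dotC -!trace_hessian_symmx eqyv.
Qed.

Lemma outer_eq0 (F : fieldType) (n : nat) (x : 'rV[F]_n) :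
  (x^T *m x == 0) = (x == 0).
Proof.
apply/eqP/eqP => [xx0|->]; last by rewrite mulmx0.
apply/eqP/negPn/negP => /exists_dot1[z zx]; have := congr1 (mulmx z) xx0.
rewrite mulmx_outer zx scale1r mulmx0 => x0.
by move/eqP: zx; rewrite x0 dotC dot0l eq_sym oner_eq0.
Qed.

Lemma rank_outer_le1 (F : fieldType) (n : nat) (c : F) (x : 'rV[F]_n) :
  (\rank (c *: (x^T *m x)) <= 1)%N.
Proof.
rewrite (leq_trans (mxrank_scale _ _)) // (leq_trans (mxrankM_maxr _ _)) //.
exact: rank_leq_row.
Qed.

(** If M = c v^T v, the vectors x in question are the multiples of v, 0 included. *)
Lemma card_veronese_multiples_rank1 (F : finFieldType) (y : 'rV[F]_6) :
    2 != 0 :> F -> \rank (symmx y) = 1%N ->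
  #|[set x | (veronese x <= y)%MS]| = #|F|.
Proof.
move=> two0 rM.
have [c [v [c0 v0 ME]]] := rank1_symmetric two0 (symmx_sym y) rM.
have := card_rowspace v; rewrite [\rank v](_ : _ = 1%N) ?expn1 => [<-|]; last first.
  by apply/eqP; rewrite eqn_leq rank_leq_row lt0n mxrank_eq0.
apply: eq_card => x; rewrite !inE; apply/sub_rVP/sub_rVP => [[d xE]|[t ->]].
  have [->|x0] := eqVneq x 0; first by exists 0; rewrite scale0r.
  have [z zx] := exists_dot1 x0.
  have := congr1 (fun u => z *m symmx u) xE; rewrite symmxZ symmx_veronese ME.
  rewrite -!scalemxAr !mulmx_outer zx scale1r !scalerA => ->.
  by exists (d * c * dot z v).
exists (t ^+ 2 / c); apply: (symmx_inj two0); rewrite symmxZ symmx_veronese ME.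
rewrite !linearZ /= -scalemxAl !scalerA; congr (_ *: _); by field.
Qed.

Lemma card_veronese_multiples (F : finFieldType) (y : 'rV[F]_6) :
    2 != 0 :> F -> (1 < \rank (symmx y))%N ->
  #|[set x | (veronese x <= y)%MS]| = 1%N.
Proof.
move=> two0 rM; apply/eqP/cards1P; exists 0; apply/setP => x; rewrite !inE.
apply/sub_rVP/eqP => [[d xE]|->]; last first.
  exists 0; apply: (symmx_inj two0).
  by rewrite symmxZ symmx_veronese mulmx0 !scale0r.
have := congr1 (@symmx F) xE; rewrite symmxZ symmx_veronese => xxE.
have [d0|d0] := eqVneq d 0.
  by apply/eqP; rewrite -outer_eq0 xxE d0 scale0r.
have := rank_outer_le1 1 x.
by rewrite scale1r xxE mxrank_scale_nz // leqNgt rM.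
Qed.

Lemma rowspaceS (F : finFieldType) (m1 m2 n : nat) (A : 'M[F]_(m1, n))
    (B : 'M[F]_(m2, n)) : (rowspace A \subset rowspace B) = (A <= B)%MS.
Proof.
apply/subsetP/rV_subP => sub v; first by have := sub v; rewrite !inE.
by rewrite !inE; exact: sub.
Qed.

(** * Tangents through a rank-2 point *)

Section Tangents.
Variables (F : finFieldType) (A : 'M[F]_(2, 3)) (y : 'rV[F]_6).
Hypotheses (two0 : 2 != 0 :> F) (freeA : row_free A).
Let M := symmx y.
Let C := [set rowspace (veronese u) | u in rowspace A & u != 0].
Hypotheses (rM : \rank M = 2%N) (yC : rowspace y \subset spanned C).

Lemma conic_point (x : 'rV[F]_3) :
  (x <= A)%MS -> x != 0 -> rowspace (veronese x) \in C.
Proof. by move=> xA x0; apply/imsetP; exists x; rewrite // !inE xA. Qed.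

Lemma conic_point_spanned (x : 'rV[F]_3) :
  (x <= A)%MS -> x != 0 -> rowspace (veronese x) \subset spanned C.
Proof.
move=> xA x0; rewrite rowspaceS.
apply: submx_trans (_ : <<veronese x>> <= _)%MS; first by rewrite genmxE.
apply: (sumsmx_sup (veronese x)) => //; apply/bigcupP.
by exists (rowspace (veronese x)); rewrite ?inE ?conic_point.
Qed.

Lemma spanned_conic (v : 'rV[F]_6) :
  rowspace v \subset spanned C -> (symmx v <= A)%MS.
Proof.
rewrite rowspaceS => /sub_sumsmxP[w ->].
have symmx0 : symmx 0 = 0 :> 'M[F]_3 by apply/matrixP => i j; rewrite !mxE.
rewrite (big_morph _ (@symmxD F) symmx0); apply: summx_sub => k.
case/bigcupP => _ /imsetP[u + ->]; rewrite !inE => /andP[uA _] /sub_rVP[c kE].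
have /sub_rVP[d ->] : (w k *m <<k>> <= k)%MS.
  by rewrite (submx_trans (submxMl _ _)) // genmxE.
rewrite kE !symmxZ symmx_veronese !scalemx_sub //.
exact: submx_trans (submxMl _ _) uA.
Qed.

(** Matrices in the span of the conic have their rows in A, and rank 2 forces equality. So M
    determines the line A, whence the uniqueness of the conic. *)
Lemma conic_plane_eq : (M :=: A)%MS.
Proof.
have MA := spanned_conic yC.
apply/eqmxP; rewrite MA -(geq_leqif (mxrank_leqif_sup MA)) rM.
by rewrite (eqP freeA).
Qed.

Lemma not_veronese_multiple (c : F) (u : 'rV[F]_3) : y != c *: veronese u.
Proof.
apply/eqP => yE; have := rank_outer_le1 c u.
by rewrite -symmx_veronese -symmxZ -yE -/M rM.
Qed.

Lemma veronese_neq0 (u : 'rV[F]_3) : u != 0 -> veronese u != 0.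
Proof.
apply: contra => /eqP u0; rewrite -outer_eq0 -symmx_veronese u0.
by apply/eqP/matrixP => i j; rewrite !mxE.
Qed.

(** For a zero z off the kernel and u = z M, the tangent is the line joining y to the conic point of
    u. *)
Lemma regular_zero_tangent :
  has_regular_zero M -> tangents C (rowspace y) != set0.
Proof.
case/exists_inP => z; rewrite inE => /eqP zMz u0; set u := z *m M in zMz u0.
have uA : (u <= A)%MS by rewrite -conic_plane_eq submxMl.
apply/set0Pn; exists (rowspace (col_mx (veronese u) y)); rewrite !inE.
apply/and4P; split.
- apply/imsetP; exists (col_mx (veronese u) y) => //.
  rewrite inE row_free_col_mx ?veronese_neq0 //.
  by apply/negP => /sub_rVP[c yE]; have /eqP[] := not_veronese_multiple c u.
- rewrite rowspaceS col_mx_sub; apply/andP.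
  by rewrite -!rowspaceS conic_point_spanned.
- by rewrite rowspaceS -addsmxE addsmxSr.
apply/cards1P; exists (rowspace (veronese u)); apply/setP => Q; rewrite !inE.
apply/andP/eqP => [[/imsetP[x + ->]]|->]; last first.
  by rewrite conic_point // rowspaceS -addsmxE addsmxSl.
rewrite !inE => /andP[xA x0]; rewrite rowspaceS => /submxP[D].
rewrite -[D]hsubmxK mul_row_col (mx11_scalar (lsubmx D)) (mx11_scalar (rsubmx D)).
rewrite !mul_scalar_mx; move: (lsubmx D 0 0) (rsubmx D 0 0) => a b xE.
have xxE := congr1 (@symmx F) xE.
rewrite symmxD !symmxZ !symmx_veronese -/M in xxE.
have b0 : b = 0.
  apply/eqP/negPn/negP => b0.
  (* As z.u = 0, applying z to x^T x = a u^T u + b M yields (z.x) x = b u. With b nonzero, u is a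
     multiple of x and y a multiple of [veronese x], against rank 2. *)
  have := congr1 (mulmx z) xxE.
  rewrite mulmxDr -!scalemxAr !mulmx_outer -/u [dot z u]dotC zMz scale0r scaler0.
  rewrite add0r => uE.
  have /eqP[] := not_veronese_multiple
    (b^-1 * (1 - a * (b^-1 * dot z x) ^+ 2)) x.
  apply: (symmx_inj two0); rewrite symmxZ symmx_veronese -/M.
  have ME : M = b^-1 *: (x^T *m x - a *: (u^T *m u)).
    by rewrite xxE addrC addrA addNr add0r scalerA mulVf // scale1r.
  have uxE : u = (b^-1 * dot z x) *: x.
    by rewrite -scalerA uE scalerA mulVf // scale1r.
  have uuE : u^T *m u = (b^-1 * dot z x) ^+ 2 *: (x^T *m x).
    by rewrite uxE !linearZ /= -scalemxAl scalerA.
  rewrite ME uuE scalerA -{1}[x^T *m x]scale1r -scalerBl.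
  by rewrite scalerA.
apply/eqP; rewrite eqEsubset !rowspaceS; rewrite b0 scale0r addr0 in xE.
have a0 : a != 0.
  by apply: contraNneq (veronese_neq0 x0) => a0; rewrite xE a0 scale0r.
by rewrite xE !eqmx_scale // submx_refl.
Qed.

(** Let the tangent touch the conic at the point of u = z M. If c = z M z^T were nonzero, Lagrange
    reduction along z would give y = d [veronese x] + c^-1 [veronese u], so the point of x would lie
    on the tangent. It would then be the point of u, and y would have rank 1. *)
Lemma tangent_regular_zero :
  tangents C (rowspace y) != set0 -> has_regular_zero M.
Proof.
case/set0Pn => t; rewrite inE => /andP[/imsetP[T freeT ->]].
case/and3P => TC; rewrite rowspaceS => yT /cards1P[Q0 QE].
have : Q0 \in [set Q0] by rewrite inE.
rewrite -QE inE => /andP[/imsetP[u + Q0E]]; rewrite !inE => /andP[uA u0].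
rewrite Q0E rowspaceS => uT.
have /submxP[z uE] : (u <= M)%MS by rewrite conic_plane_eq.
apply/exists_inP; exists z; last by rewrite -uE.
rewrite inE; apply/negPn/negP; set c := dot _ _ => c0.
have := rank_reduction (symmx_sym y) c0; rewrite -/M -/c -uE rM => -[rS'].
set S' := M - _ in rS'.
have symS' : S'^T = S'.
  by rewrite linearB linearZ /= trmx_mul trmxK symmx_sym.
have [d [x [d0 x0 S'E]]] := rank1_symmetric two0 symS' rS'.
have S'A : (S' <= A)%MS.
  rewrite addmx_sub ?conic_plane_eq // eqmx_opp scalemx_sub //.
  exact: submx_trans (submxMl _ _) uA.
have xA : (x <= A)%MS.
  have [w wx] := exists_dot1 x0; apply: submx_trans S'A; apply/submxP.
  exists (d^-1 *: w).
  by rewrite S'E -scalemxAl -scalemxAr mulmx_outer wx scale1r scalerA mulVf // scale1r.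
have yE : y = d *: veronese x + c^-1 *: veronese u.
  apply: (symmx_inj two0); rewrite symmxD !symmxZ !symmx_veronese -S'E.
  by rewrite /S' subrK.
have : rowspace (veronese x) \in [set Q0].
  rewrite -QE inE conic_point // rowspaceS.
  have -> : veronese x = d^-1 *: (y - c^-1 *: veronese u).
    by rewrite yE addrK scalerA mulVf // scale1r.
  by rewrite scalemx_sub // addmx_sub // eqmx_opp scalemx_sub.
rewrite inE Q0E => /eqP eqQ.
have /sub_rVP[k xE] : (veronese x <= veronese u)%MS.
  by rewrite -rowspaceS eqQ.
have /eqP[] := not_veronese_multiple (d * k + c^-1) u.
by rewrite yE xE scalerA -scalerDl.
Qed.

End Tangents.

(** * Solving the system for each point orbit *)

Lemma has_regular_zeroZ (F : finFieldType) (n : nat) (c : F) (S : 'M[F]_n) :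
  c != 0 -> has_regular_zero (c *: S) = has_regular_zero S.
Proof.
move=> c0; apply: eq_existsb => z.
by rewrite !inE -!scalemxAr dotZl mulf_eq0 scaler_eq0 (negPf c0).
Qed.

(** The true counts satisfy the same four equations as the candidates, and each equation brings in
    one new unknown with a nonzero coefficient, so cancellation identifies them one by one. Each
    orbit is thereby reduced to field identities. *)
Lemma OD4_eq (F L : finFieldType) (iota : {rmorphism F -> L}) (y : 'rV[F]_6)
    (h1 h2r h2i h3 : rat) (q : rat := #|F|%:R)
    (N := #|isotropic (symmx y)|%:R : rat) (K := q ^+ (3 - \rank (symmx y)))
    (e := #|[set x | (veronese x <= y)%MS]|%:R : rat) :
    odd #|F| -> #|L| = (#|F| ^ 2)%N -> y != 0 ->
    (q - 1) * h1 + 1 = N ->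
    2 * (q - 1) * ((q - 1) * h2r) + q ^+ 3 + (N - 1) * q + (q ^+ 3 - N)
      = K * q ^+ 3 + (q ^+ 3 - K) * q ^+ 2 ->
    q ^+ 7 + (q ^+ 2 - q) * ((q - 1) * h2r - (q - 1) * h2i) + (q ^+ 3 - q ^+ 2)
      = e * q ^+ 5 + (q ^+ 3 - e) * q ^+ 4 ->
    1 + (q - 1) * h1 + (q - 1) * h2r + (q - 1) * h2i + (q - 1) * h3 = q ^+ 5 ->
  [seq h%:R | h <- OD4 iota (rowspace y)] = [:: h1; h2r; h2i; h3].
Proof.
move=> oddF cardL y0 e1 e2 e3 e4; have two0 := two_neq0 oddF.
have q_gt1 := finNzRing_gt1 F.
have q0 : q != 0 by rewrite Num.Theory.pnatr_eq0 -lt0n ltnW.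
have q1 : q - 1 != 0 by rewrite subr_eq0 -[1]/(1%:R) Num.Theory.eqr_nat gtn_eqF.
have qE : #|F|.-1%:R = q - 1 by rewrite -subn1 natrB // ltnW.
have containingE (p : pred {mpoly F[3]}) (t : pred 'M[F]_3) :
    (forall a, p (quadform a) = t (hessian a)) ->
    (forall c W, c != 0 -> t (c *: W) = t W) ->
    (q - 1) * (containing (rowspace y) (hyperplanes_of p))%:R
      = #|annihilators t y|%:R.
  by move=> pt tZ; rewrite (card_annihilators y pt tZ) natrM qE mulrC.
have {containingE} [c1 c2r c2i c3] := And4
  (containingE _ _ (fun a => double_lineE a two0)
     (fun c W c0 => congr1 (fun r => r == 1%N) (mxrank_scale_nz W c0)))
  (containingE _ (fun W => (\rank W == 2%N) && has_regular_zero W)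
     (fun a => real_line_pairE a two0)
     (fun c W c0 => congr2 (fun r b => (r == 2%N) && b)
        (mxrank_scale_nz W c0) (has_regular_zeroZ W c0)))
  (containingE _ (fun W => (\rank W == 2%N) && ~~ has_regular_zero W)
     (fun a => imaginary_line_pairE iota a oddF cardL)
     (fun c W c0 => congr2 (fun r b => (r == 2%N) && ~~ b)
        (mxrank_scale_nz W c0) (has_regular_zeroZ W c0)))
  (containingE _ _ (fun a => nonsingularE a two0)
     (fun c W c0 => congr1 (fun r => r == 3%N) (mxrank_scale_nz W c0))).
have := annihilators_rank1 y oddF; rewrite -c1 -/N -e1 => /addIr/(mulfI q1) h1E.
have := annihilators_rank2_regular y oddF; cbv zeta; rewrite -c2r -/q -/N -/K -e2.
move=> /addIr/addIr/addIr.
have qq1 : 2 * (q - 1) != 0 by rewrite mulf_neq0.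
move=> /(mulfI qq1)/(mulfI q1) h2rE.
have := annihilators_zeros oddF y0; cbv zeta; rewrite -c2r -c2i -/q -/e -e3 h2rE.
have qq : q ^+ 2 - q != 0 by rewrite expr2 -{3}[q]mulr1 -mulrBr mulf_neq0.
move=> /addIr/addrI/(mulfI qq)/addrI/oppr_inj/(mulfI q1) h2iE.
have := annihilators_total oddF y0; rewrite -c1 -c2r -c2i -c3 -/q -e4.
by rewrite h1E h2rE h2iE => /addrI/(mulfI q1) h3E; rewrite /= h1E h2rE h2iE h3E.
Qed.

Theorem theorem3p2 (F L : finFieldType) (iota : {rmorphism F -> L})
    (oddF : odd #|F|) (quadL : #|L| = (#|F| ^ 2)%N)
    (P : {set 'rV[F]_6}) (pointP : P \in PG F 5 0) :
  let q : rat := #|F|%:R in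
  let OD : seq rat := [seq h%:R | h <- OD4 iota P] in
  [/\ P \in orbit_P1 F ->
        OD = [:: q + 1; q ^+ 3 + (3 * q ^+ 2 + q) / 2; (q ^+ 2 - q) / 2;
                 q ^+ 4 - q ^+ 2],
      P \in orbit_P2e F ->
        OD = [:: 2 * q + 1; (q ^+ 3 + 3 * q ^+ 2) / 2;
                 (q ^+ 3 + q ^+ 2) / 2 - q; q ^+ 4 - q ^+ 2],
      P \in orbit_P2i F ->
        OD = [:: 1; (q ^+ 3 + 3 * q ^+ 2) / 2 + q; (q ^+ 3 + q ^+ 2) / 2;
                 q ^+ 4 - q ^+ 2]
    & P \in orbit_P3 F ->
        OD = [:: q + 1; (q ^+ 3 + 2 * q ^+ 2 + q) / 2; (q ^+ 3 - q) / 2;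
                 q ^+ 4]].
Proof.
move=> q OD.
have two0 := two_neq0 oddF.
have OD_of (y : 'rV[F]_6) h1 h2r h2i h3 : P = rowspace y ->
    [seq h%:R | h <- OD4 iota (rowspace y)] = [:: h1; h2r; h2i; h3] :> seq rat ->
  OD = [:: h1; h2r; h2i; h3] by move=> PE <-; rewrite /OD PE.
(* Positivity of k separates exterior points, k = 2, from interior ones, k = 0. *)
have rank2_point k : P \in rank2_points_on F k ->
  exists y, [/\ P = rowspace y, y != 0, \rank (symmx y) = 2%N
              & has_regular_zero (symmx y) = (0 < k)%N].
  rewrite inE => /andP[/imsetP[y + PE]].
  rewrite inE => /andP[y0 /eqP rM] /exists_inP[C CV /andP[PC /eqP kE]].
  exists y; split=> //; rewrite -kE card_gt0.
  have [l /imsetP[A]] := imsetP CV; rewrite inE => freeA lE CE.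
  rewrite {}CE {}lE PE in PC *.
  by apply/idP/idP => [/(regular_zero_tangent two0 freeA rM PC)
                      |/(tangent_regular_zero two0 freeA rM PC)].
split.
(* Here N = q^2, K = q^2 and e = q. *)
- case/imsetP => y + PE; rewrite inE => /andP[y0 /eqP rM].
  apply: (OD_of y _ _ _ _ PE); have symM := symmx_sym y.
  apply: OD4_eq => //; rewrite ?rM ?card_veronese_multiples_rank1 //;
    rewrite ?card_isotropic_singular ?rank1_no_regular_zero // ?rM ?natrX -/q; by field.
(* Here N = 2 q^2 - q, K = q and e = 1. *)
- case/rank2_point => y [PE y0 rM reg].
  have [l [m [free ME]]] := rank2_regular_zeroP two0 (symmx_sym y) rM reg.
  have NE : #|isotropic (symmx y)|%:R = 2 * q ^+ 2 - q.
    have /(congr1 (fun n => n%:R : rat)) := card_isotropic_symouter two0 free.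
    by rewrite -ME natrD natrM !natrX -/q /= => <-; rewrite addrK.
  apply: (OD_of y _ _ _ _ PE).
  apply: OD4_eq => //; rewrite ?NE ?rM ?card_veronese_multiples ?rM // -/q; by field.
(* The zeros are the kernel: N = K = q and e = 1. *)
- case/rank2_point => y [PE y0 rM /negbT reg].
  apply: (OD_of y _ _ _ _ PE).
  apply: OD4_eq => //; rewrite ?card_isotropic_singular ?rM
    ?card_veronese_multiples ?rM // ?natrX -/q; by field.
(* Here N = q^2, K = 1 and e = 1. *)
case/imsetP => y + PE; rewrite inE => /andP[y0 /eqP rM].
apply: (OD_of y _ _ _ _ PE); have symM := symmx_sym y.
apply: OD4_eq => //; rewrite ?card_isotropic_rank3 ?rM
  ?card_veronese_multiples ?rM // ?natrX -/q; by field.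
Qed.
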